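(* Let $n\in\mathbb{N}$, $1<\alpha\le 3/2$, $\lambda\in\mathbb{C}$ with $|\lambda|\le\frac{1}{n+1}$, and let $f=h+\overline{g}\in\mathcal{F}(\alpha,\lambda,n)$ with $h(z)=z+\sum_{k=2}^{\infty}a_kz^k$ and $g(z)=\sum_{k=1}^{\infty}b_kz^k$. Then the coefficients of $h$ satisfy $$|a_k|\le\frac{2(\alpha-1)}{(k-1)k}\quad(k\ge 2),$$ and the coefficients $b_k$ ($k=n+1,n+2,\ldots$) of $g$ satisfy $$|b_{n+1}|\le\frac{|\lambda|}{n+1}\quad\text{and}\quad |b_{k+n}|\le\frac{2|\lambda|(\alpha-1)}{(k-1)k(k+n)}\quad(k\in\mathbb{N}\setminus\{1\}).$$ The bounds are sharp: for each $k\ge2$, the extremal function is $$f(z)=\int_0^z\left(1-t^{k-1}\right)^{\frac{2(\alpha-1)}{k-1}}dt+\overline{\int_0^z\lambda t^n\left(1-t^{k-1}\right)^{\frac{2(\alpha-1)}{k-1}}dt}.$$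
   Context: $\mathbb{D}=\{z\in\mathbb{C}:|z|<1\}$, $\mathbb{N}=\{1,2,3,\ldots\}$. $\mathcal{H}$ is the class of harmonic functions $f=h+\overline{g}$ in $\mathbb{D}$, with $h,g$ analytic in $\mathbb{D}$, normalized by $f(0)=f_z(0)-1=0$, of the form $f(z)=z+\sum_{k=2}^{\infty}a_kz^k+\overline{\sum_{k=1}^{\infty}b_kz^k}$. For $n\in\mathbb{N}$, $1<\alpha\le 3/2$ and $\lambda\in\mathbb{C}$ with $|\lambda|\le\frac1{n+1}$, $\mathcal{F}(\alpha,\lambda,n)$ is the class of $f=h+\overline{g}\in\mathcal{H}$ such that $\mathrm{Re}\left(1+\frac{zh''(z)}{h'(z)}\right)<\alpha$ and $g'(z)=\lambda z^nh'(z)$ for all $z\in\mathbb{D}$.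
   Formalization: The printed bound on |b_{k+n}| is false (n=1, α=3/2, λ=1/2, h=z−z²/2 gives |b_3|=1/6>1/12); the formal theorem proves, with sharpness, the corrected bound |b_{k+n}| ≤ 2|λ|(α−1)/((k−1)(k+n)), without the factor k in the denominator. *)

(* Defs.v *)
(* Stdlib reals with Coquelicot (complex numbers, derivatives, power series,
   Riemann integrals). *)
From Stdlib Require Import Reals.
From Coquelicot Require Export Coquelicot.

Open Scope R_scope.

Definition unit_disk (z : C) : Prop := Cmod z < 1.

(* [C_derive] is only meaningful where the function is complex differentiable;
   it is used below for functions which are analytic in the disk. *)
Definition analytic_in_disk (h : C -> C) : Prop :=
  forall z : C, unit_disk z -> ex_derive (K := C_AbsRing) (V := C_NormedModule) h z.

Definition has_expansion (h : C -> C) (a : nat -> C) : Prop :=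
  forall z : C, unit_disk z ->
    is_pseries (K := C_AbsRing) (V := C_NormedModule) a z (h z).

(* The Wirtinger derivative f_z = (f_x - i f_y) / 2, with f = u + i v, i.e.
   ((u_x + v_y) + i (v_x - u_y)) / 2. *)
Definition wirtinger_dz (f : C -> C) (z : C) : C :=
  ((Derive (fun x : R => Re (f (x, Im z))) (Re z)
    + Derive (fun y : R => Im (f (Re z, y))) (Im z)) / 2,
   (Derive (fun x : R => Im (f (x, Im z))) (Re z)
    - Derive (fun y : R => Re (f (Re z, y))) (Im z)) / 2).

(* Membership of f = h + conj g in the class H, together with the functions
   h, g of the decomposition and their Taylor coefficients.  These are
   determined by the restriction of f to the disk, because h 0 = g 0 = 0.
   Harmonicity of f is implied by the decomposition. *)
Record class_H (f h g : C -> C) (a b : nat -> C) : Prop := {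
  class_H_decomp : forall z : C, unit_disk z -> f z = (h z + Cconj (g z))%C;
  class_H_h_analytic : analytic_in_disk h;
  class_H_g_analytic : analytic_in_disk g;
  class_H_f_0 : f (RtoC 0) = RtoC 0;
  class_H_fz_0 : wirtinger_dz f (RtoC 0) = RtoC 1;
  class_H_a_0 : a 0%nat = RtoC 0;
  class_H_a_1 : a 1%nat = RtoC 1;
  class_H_b_0 : b 0%nat = RtoC 0;
  class_H_h_expansion : has_expansion h a;
  class_H_g_expansion : has_expansion g b
}.

(* The non-vanishing of h' is part of the meaning of the quotient z h'' / h':
   division is total here, and the inequality alone would hold at a zero of h'. *)
Record class_F (alpha : R) (lambda : C) (n : nat)
    (f h g : C -> C) (a b : nat -> C) : Prop := {
  class_F_H : class_H f h g a b;
  class_F_deriv_neq_0 :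
    forall z : C, unit_disk z -> C_derive h z <> RtoC 0;
  class_F_Re_lt :
    forall z : C, unit_disk z ->
      Re (1 + z * C_derive (C_derive h) z / C_derive h z)%C < alpha;
  class_F_dilatation :
    forall z : C, unit_disk z ->
      C_derive g z = (lambda * z ^ n * C_derive h z)%C
}.

(* Principal argument, with values in (-PI, PI] for w <> 0. *)
Definition Carg (w : C) : R :=
  if Rle_dec 0 (Im w) then acos (Re w / Cmod w) else - acos (Re w / Cmod w).

Definition Clog (w : C) : C := (ln (Cmod w), Carg w).

Definition Cexp (w : C) : C := (exp (Re w) * cos (Im w), exp (Re w) * sin (Im w)).

(* Principal branch of w^p, for w <> 0. *)
Definition Crpow (w : C) (p : R) : C := Cexp (RtoC p * Clog w)%C.

(* The integral of phi from 0 to z, along the segment [0, z]. *)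
Definition Cint0 (phi : C -> C) (z : C) : C :=
  (z * RInt (V := C_R_CompleteNormedModule) (fun s : R => phi (RtoC s * z)%C) 0 1)%C.

Definition extremal_deriv (alpha : R) (k : nat) (t : C) : C :=
  Crpow (1 - t ^ (k - 1))%C (2 * (alpha - 1) / INR (k - 1)).

Definition extremal_h (alpha : R) (k : nat) (z : C) : C :=
  Cint0 (extremal_deriv alpha k) z.

Definition extremal_g (alpha : R) (lambda : C) (n k : nat) (z : C) : C :=
  Cint0 (fun t : C => (lambda * t ^ n * extremal_deriv alpha k t)%C) z.

Definition extremal_f (alpha : R) (lambda : C) (n k : nat) (z : C) : C :=
  (extremal_h alpha k z + Cconj (extremal_g alpha lambda n k z))%C.

(* Main.v *)
Require Import Defs.
From Stdlib Require Import Reals Lra Lia IndefiniteDescription.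
From Coquelicot Require Import Coquelicot.

(** Put [be = 2 (alpha - 1)], which lies in (0, 1], and let [d k] be the
    coefficients of [h'], so that [d 0 = 1] and [d k = (k + 1) a (k + 1)].
    Everything follows from [k |d k| <= be] for [k >= 1]: dividing by [k + 1]
    gives the bound on the coefficients of [h], and the equation
    [g' = lambda z ^ n h'] transports it to [g], because it says that
    [(j + n + 1) b (j + n + 1) = lambda d j].

    The bound on [d] is an instance of a method of Clunie.  With [A = z h''] and
    [B = z h'' - be h'] the hypothesis [Re (z h'' / h') < be / 2] says exactly
    that [|A| < |B|]: the quotient [z h'' / h'] is closer to [0] than to [be].
    Hence [w = A / B] is analytic with [|w| <= 1], and since [A 0 = 0] the
    product of [w] with the Taylor polynomial [Q] of degree [m] of [B] has the
    same terms up to degree [m + 1] as [A].  Comparing mean squares on the circle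
    of radius [r] (Parseval) yields
    [sum_{k <= m + 1} k^2 |d k|^2 r^(2 k) <= sum_{k <= m} (k - be)^2 |d k|^2 r^(2 k)]
    ([clunie_inequality]).  As [(k - be)^2 <= k^2] for [k >= 1], cancellation
    leaves [(m + 1)^2 |d (m + 1)|^2 r^(2 m + 2) <= be^2 |d 0|^2], and [r]
    tends to [1].

    The function theory behind this is elementary.  A power series that converges
    in the disk can be differentiated termwise ([expansion_derive]), and a
    function with continuous complex derivative has the mean value property
    ([mean_value]): differentiate its mean over the circle of radius [r] with
    respect to [r]; the result times [r] is the integral of a derivative with
    respect to the angle, which vanishes by periodicity.  Power series enter
    quotients such as [A / B] only through this mean value property, so no
    expansion of a quotient is ever needed.

    For sharpness, the function [(1 - t ^ m) ^ p] with [m = k - 1] and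
    [p = be / m] is the binomial series evaluated at [t ^ m]
    ([binomial_series_sum]): both sides solve the same linear differential
    equation along each radius.  This gives its expansion, whose coefficient of
    [t ^ m] is [- p], and its logarithmic derivative
    [t F' / F = - be t ^ m / (1 - t ^ m)], whose real part is below [be / 2]
    because [w / (1 - w)] maps the disk into [Re > - 1 / 2]. *)

(** * Complex derivatives *)

(* The library states equalities of reals in the carrier of a canonical
   structure, where [ring] and [field] do not recognise the type [R]. *)
Ltac eqR := match goal with |- ?a = ?b => change (@eq R a b) end.

Notation Cderiv := (is_derive (K := C_AbsRing) (V := C_NormedModule)).

Lemma Cderiv_iff_eps f z l :
  Cderiv f z l <->
  forall eps, 0 < eps -> exists delta, 0 < delta /\
    forall w, Cmod (w - z) < delta ->
      Cmod (f w - f z - (w - z) * l)%C <= eps * Cmod (w - z).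
Proof.
split.
- intros [_ H] eps He.
  destruct (H z (fun P HP => HP) (mkposreal eps He)) as [d Hd].
  exists d. split; [apply cond_pos|].
  intros w Hw. exact (Hd w Hw).
- intros H. split; [apply is_linear_scal_l|].
  intros x Hx.
  replace x with z.
  2:{ apply (is_filter_lim_locally_unique (K := C_AbsRing) (V := AbsRing_NormedModule C_AbsRing)). exact Hx. }
  intros [eps He]. destruct (H eps He) as [d [Hd Hd']].
  exists (mkposreal d Hd). intros w Hw. exact (Hd' w Hw).
Qed.

(** Products and compositions are available for maps of an absolute ring into
    itself; there the complex plane carries another normed module structure, with
    the same norm and hence the same derivatives. *)
Lemma Cderiv_ring f z l :
  Cderiv f z l <->
  is_derive (K := C_AbsRing) (V := AbsRing_NormedModule C_AbsRing) f z l.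
Proof.
split; intros [_ H]; (split; [apply is_linear_scal_l | exact H]).
Qed.

Lemma Cderiv_const c z : Cderiv (fun _ => c) z (RtoC 0).
Proof. apply (is_derive_const (K := C_AbsRing) (V := C_NormedModule)). Qed.

Lemma Cderiv_id z : Cderiv (fun w => w) z (RtoC 1).
Proof. apply Cderiv_ring. apply (is_derive_id (K := C_AbsRing)). Qed.

Lemma Cderiv_plus f g z lf lg :
  Cderiv f z lf -> Cderiv g z lg -> Cderiv (fun w => f w + g w)%C z (lf + lg)%C.
Proof. apply (is_derive_plus (K := C_AbsRing) (V := C_NormedModule)). Qed.

Lemma Cderiv_mult f g z lf lg :
  Cderiv f z lf -> Cderiv g z lg ->
  Cderiv (fun w => f w * g w)%C z (lf * g z + f z * lg)%C.
Proof.
intros Hf Hg. apply Cderiv_ring.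
apply (is_derive_mult (K := C_AbsRing)).
- now apply Cderiv_ring.
- now apply Cderiv_ring.
- apply Cmult_comm.
Qed.

Lemma Cderiv_comp f g z lf lg :
  Cderiv f (g z) lf -> Cderiv g z lg -> Cderiv (fun w => f (g w)) z (lg * lf)%C.
Proof.
intros Hf Hg.
apply (is_derive_comp (K := C_AbsRing) (V := C_NormedModule)).
- exact Hf.
- now apply Cderiv_ring.
Qed.

(** The disk is open, so a derivative there only depends on the values there. *)
Lemma Cderiv_ext_disk f g z l :
  (forall w, unit_disk w -> f w = g w) -> unit_disk z ->
  Cderiv f z l -> Cderiv g z l.
Proof.
intros E Hz H. apply Cderiv_iff_eps. intros eps He.
destruct (proj1 (Cderiv_iff_eps f z l) H eps He) as [d [Hd H']].
unfold unit_disk in *.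
exists (Rmin d (1 - Cmod z)). split; [apply Rmin_pos; lra|].
intros w Hw.
assert (Cmod (w - z) < d) by (eapply Rlt_le_trans; [exact Hw|apply Rmin_l]).
assert (Cmod (w - z) < 1 - Cmod z) by (eapply Rlt_le_trans; [exact Hw|apply Rmin_r]).
assert (Cmod w < 1).
{ replace w with ((w - z) + z)%C by ring.
  pose proof (Cmod_triangle (w - z) z). lra. }
rewrite <- !E by (unfold unit_disk; assumption). now apply H'.
Qed.

Lemma Cderiv_continuous f z l :
  Cderiv f z l -> continuous (T := C_UniformSpace) (U := C_UniformSpace) f z.
Proof.
intros H.
assert (H1 : continuous (T := AbsRing_UniformSpace C_AbsRing)
                        (U := C_UniformSpace) f z).
{ apply (ex_derive_continuous (K := C_AbsRing) (V := C_NormedModule)). now exists l. }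
intros P HP. apply locally_C. exact (H1 P HP).
Qed.

Lemma Cderiv_inv z : z <> RtoC 0 -> Cderiv Cinv z (- / (z * z))%C.
Proof.
intros Hz. apply Cderiv_iff_eps. intros eps He.
pose proof (proj1 (Cmod_gt_0 z) Hz) as Hm.
exists (Rmin (Cmod z / 2) (eps * Cmod z ^ 3 / 2)).
split.
{ apply Rmin_pos; [lra|]. apply Rmult_lt_0_compat; [|lra].
  apply Rmult_lt_0_compat; [lra|]. now apply pow_lt. }
intros w Hw.
assert (H1 : Cmod (w - z) < Cmod z / 2) by (eapply Rlt_le_trans; [exact Hw|apply Rmin_l]).
assert (H2 : Cmod (w - z) < eps * Cmod z ^ 3 / 2)
  by (eapply Rlt_le_trans; [exact Hw|apply Rmin_r]).
assert (Hw2 : Cmod z / 2 < Cmod w).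
{ pose proof (Cmod_triangle w (- (w - z))) as T.
  rewrite Cmod_opp in T. replace (w + - (w - z))%C with z in T by ring. lra. }
assert (Hw0 : w <> RtoC 0) by (apply Cmod_gt_0; lra).
replace (/ w - / z - (w - z) * - / (z * z))%C
  with ((w - z) * (w - z) / (w * (z * z)))%C by (field; auto).
rewrite Cmod_div by (repeat apply Cmult_neq_0; auto).
rewrite !Cmod_mult.
apply Rle_div_l; [repeat apply Rmult_lt_0_compat; lra|].
rewrite (Rmult_comm eps), Rmult_assoc.
apply Rmult_le_compat_l; [apply Cmod_ge_0|].
apply Rle_trans with (1 := Rlt_le _ _ H2).
assert (0 < eps * (Cmod z * Cmod z)) by (repeat apply Rmult_lt_0_compat; lra).
nra.
Qed.

(** * Curves in the complex plane *)

Definition curve_deriv (c : R -> C) (t : R) (v : C) : Prop :=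
  is_derive (fun s => fst (c s)) t (fst v) /\
  is_derive (fun s => snd (c s)) t (snd v).

Lemma is_derive_eps (f : R -> R) t a :
  is_derive f t a ->
  forall eps, 0 < eps -> exists delta, 0 < delta /\
    forall s, Rabs (s - t) < delta ->
      Rabs (f s - f t - (s - t) * a) <= eps * Rabs (s - t).
Proof.
intros [_ H] eps He.
destruct (H t (fun P HP => HP) (mkposreal eps He)) as [d Hd].
exists d. split; [apply cond_pos|]. intros s Hs. exact (Hd s Hs).
Qed.

Lemma curve_lipschitz c t v :
  curve_deriv c t v ->
  exists L delta, 0 < L /\ 0 < delta /\
    forall s, Rabs (s - t) < delta -> Cmod (c s - c t)%C <= L * Rabs (s - t).
Proof.
intros [H1 H2].
destruct (is_derive_eps _ _ _ H1 1 Rlt_0_1) as [d1 [Hd1 K1]].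
destruct (is_derive_eps _ _ _ H2 1 Rlt_0_1) as [d2 [Hd2 K2]].
exists (sqrt 2 * (1 + Rabs (fst v) + Rabs (snd v))), (Rmin d1 d2).
pose proof (Rabs_pos (fst v)). pose proof (Rabs_pos (snd v)).
pose proof (sqrt_lt_R0 2 ltac:(lra)).
split; [apply Rmult_lt_0_compat; lra|].
split; [now apply Rmin_pos|].
intros s Hs.
assert (S1 := K1 s (Rlt_le_trans _ _ _ Hs (Rmin_l _ _))).
assert (S2 := K2 s (Rlt_le_trans _ _ _ Hs (Rmin_r _ _))).
assert (Hx : forall x a, Rabs (x - (s - t) * a) <= 1 * Rabs (s - t) ->
   Rabs x <= (1 + Rabs a) * Rabs (s - t)).
{ intros x a Hx. replace x with ((x - (s - t) * a) + (s - t) * a) by ring.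
  eapply Rle_trans; [apply Rabs_triang|]. rewrite Rabs_mult. nra. }
apply Hx in S1. apply Hx in S2.
pose proof (Rabs_pos (s - t)).
eapply Rle_trans; [apply Cmod_2Rmax|].
rewrite Rmult_assoc. apply Rmult_le_compat_l; [lra|].
change (fst (c s - c t)%C) with (fst (c s) - fst (c t)).
change (snd (c s - c t)%C) with (snd (c s) - snd (c t)).
apply Rmax_lub; nra.
Qed.

Lemma is_derive_small (f : R -> R) t :
  (forall eps, 0 < eps -> exists delta, 0 < delta /\
    forall s, Rabs (s - t) < delta -> Rabs (f s) <= eps * Rabs (s - t)) ->
  is_derive f t 0.
Proof.
intros H. split; [apply is_linear_scal_l|].
intros x Hx. replace x with t.
2:{ apply (is_filter_lim_locally_unique (K := R_AbsRing) (V := R_NormedModule)). exact Hx. }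
assert (F0 : f t = 0).
{ destruct (H 1 Rlt_0_1) as [d [Hd K]].
  specialize (K t). rewrite Rminus_diag, Rabs_R0 in K. specialize (K Hd).
  pose proof (Rabs_pos (f t)). destruct (Req_dec (f t) 0) as [E|E]; auto.
  apply Rabs_pos_lt in E. lra. }
intros [eps He]. destruct (H eps He) as [d [Hd K]].
exists (mkposreal d Hd). intros s Hs. specialize (K s Hs).
unfold norm, minus, plus, opp, scal; simpl. unfold abs, mult; simpl.
rewrite F0. replace (f s + - 0 + - ((s + - t) * 0)) with (f s) by ring.
exact K.
Qed.

(** In the chain rule below, [r] is the remainder of a first order expansion and
    the other summands are a real-linear function of the two coordinates. *)
Lemma is_derive_affine (r x y : R -> R) t k a b dr dx dy :
  is_derive r t dr -> is_derive x t dx -> is_derive y t dy ->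
  is_derive (fun s => r s + (k + ((x s - x t) * a + (y s - y t) * b))) t
    (dr + (dx * a + dy * b)).
Proof.
intros Hr Hx Hy.
auto_derive; [repeat split; eexists; eassumption|].
rewrite (is_derive_unique (fun s : R => r s) _ _ Hr),
  (is_derive_unique (fun s : R => x s) _ _ Hx), (is_derive_unique (fun s : R => y s) _ _ Hy).
ring.
Qed.

(** The remainder of [F] at [c t] is small compared with [c s - c t], hence with
    [s - t], as a differentiable curve is locally Lipschitz. *)
Lemma curve_deriv_comp F c t l v :
  Cderiv F (c t) l -> curve_deriv c t v ->
  curve_deriv (fun s => F (c s)) t (v * l)%C.
Proof.
intros HF Hc.
destruct (curve_lipschitz _ _ _ Hc) as [L [d [HL [Hd HLd]]]].
pose (rem := fun s => (F (c s) - F (c t) - (c s - c t) * l)%C).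
assert (small : forall eps, 0 < eps -> exists delta, 0 < delta /\
    forall s, Rabs (s - t) < delta -> Cmod (rem s) <= eps * Rabs (s - t)).
{ intros eps He.
  destruct (proj1 (Cderiv_iff_eps _ _ _) HF (eps / L)) as [d' [Hd' K]].
  { now apply Rdiv_lt_0_compat. }
  exists (Rmin d (d' / L)). split.
  { apply Rmin_pos; auto. now apply Rdiv_lt_0_compat. }
  intros s Hs.
  assert (M := HLd s (Rlt_le_trans _ _ _ Hs (Rmin_l _ _))).
  assert (M2 := Rlt_le_trans _ _ _ Hs (Rmin_r _ _)).
  eapply Rle_trans; [apply K|].
  { eapply Rle_lt_trans; [apply M|].
    apply Rlt_div_r in M2; auto. lra. }
  replace (eps * Rabs (s - t)) with (eps / L * (L * Rabs (s - t))) by (field; lra).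
  apply Rmult_le_compat_l; auto. apply Rlt_le. now apply Rdiv_lt_0_compat. }
assert (parts : forall z, Rabs (fst z) <= Cmod z /\ Rabs (snd z) <= Cmod z).
{ intros z. pose proof (Rmax_Cmod z).
  split; (eapply Rle_trans; [|exact H]); [apply Rmax_l|apply Rmax_r]. }
assert (D1 : is_derive (fun s => fst (rem s)) t 0).
{ apply is_derive_small. intros eps He. destruct (small eps He) as [d' [Hd' K]].
  exists d'. split; auto. intros s Hs.
  eapply Rle_trans; [apply parts|now apply K]. }
assert (D2 : is_derive (fun s => snd (rem s)) t 0).
{ apply is_derive_small. intros eps He. destruct (small eps He) as [d' [Hd' K]].
  exists d'. split; auto. intros s Hs.
  eapply Rle_trans; [apply parts|now apply K]. }
destruct Hc as [C1 C2].
destruct l as [l1 l2], v as [v1 v2].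
split.
- apply is_derive_ext with
    (fun s => fst (rem s) +
       (fst (F (c t)) + ((fst (c s) - fst (c t)) * l1 + (snd (c s) - snd (c t)) * - l2))).
  { intros s. unfold rem, Cminus, Cplus, Copp, Cmult; cbn [fst snd];
    eqR; ring. }
  replace (fst ((v1, v2) * (l1, l2))%C) with (0 + (v1 * l1 + v2 * - l2))
    by (simpl; ring).
  now apply (is_derive_affine (fun s => fst (rem s)) (fun s => fst (c s)) (fun s => snd (c s))).
- apply is_derive_ext with
    (fun s => snd (rem s) +
       (snd (F (c t)) + ((fst (c s) - fst (c t)) * l2 + (snd (c s) - snd (c t)) * l1))).
  { intros s. unfold rem, Cminus, Cplus, Copp, Cmult; cbn [fst snd];
    eqR; ring. }
  replace (snd ((v1, v2) * (l1, l2))%C) with (0 + (v1 * l2 + v2 * l1))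
    by (simpl; ring).
  now apply (is_derive_affine (fun s => snd (rem s)) (fun s => fst (c s)) (fun s => snd (c s))).
Qed.

Lemma curve_deriv_mult c1 c2 t v1 v2 :
  curve_deriv c1 t v1 -> curve_deriv c2 t v2 ->
  curve_deriv (fun s => c1 s * c2 s)%C t (v1 * c2 t + c1 t * v2)%C.
Proof.
intros [A1 A2] [B1 B2].
assert (K : forall (x y z w : R -> R) a b e dx dy dz dw, is_derive x t dx -> is_derive y t dy ->
  is_derive z t dz -> is_derive w t dw ->
  a = dx * y t + x t * dy + e * (dz * w t + z t * dw) ->
  b = e ->
  is_derive (fun s => x s * y s + b * (z s * w s)) t a).
{ intros x y z w a b e dx dy dz dw Hx Hy Hz Hw -> ->.
  auto_derive; [repeat split; eexists; eassumption|].
  rewrite (is_derive_unique (fun s : R => x s) _ _ Hx), (is_derive_unique (fun s : R => y s) _ _ Hy),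
    (is_derive_unique (fun s : R => z s) _ _ Hz), (is_derive_unique (fun s : R => w s) _ _ Hw).
  ring. }
split.
- eapply is_derive_ext.
  2:{ apply (K _ _ _ _ _ (-1) (-1) _ _ _ _ A1 B1 A2 B2); [|reflexivity].
      simpl. ring. }
  intros s. simpl. eqR; ring.
- eapply is_derive_ext.
  2:{ apply (K _ _ _ _ _ 1 1 _ _ _ _ A1 B2 A2 B1); [|reflexivity].
      simpl. ring. }
  intros s. simpl. eqR; ring.
Qed.

Lemma curve_deriv_eq c t v w : v = w -> curve_deriv c t v -> curve_deriv c t w.
Proof. now intros ->. Qed.

Lemma curve_deriv_0_const c :
  (forall t, 0 <= t <= 1 -> curve_deriv c t (RtoC 0)) -> c 1 = c 0.
Proof.
intros H.
assert (K : forall f : R -> R, (forall t, 0 <= t <= 1 -> is_derive f t 0) -> f 1 = f 0).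
{ intros f Hf. apply sym_eq. apply (eq_is_derive f 0 1); [|lra].
  exact Hf. }
apply injective_projections.
- apply (K (fun t => fst (c t))). intros t Ht. apply H; auto.
- apply (K (fun t => snd (c t))). intros t Ht. apply H; auto.
Qed.

(** * Complex power series *)

Notation Cseries := (is_series (K := C_AbsRing) (V := C_NormedModule)).
Notation Cpseries := (is_pseries (K := C_AbsRing) (V := C_NormedModule)).

Lemma pow_n_Cpow (z : C) k : pow_n (K := C_Ring) z k = (z ^ k)%C.
Proof. induction k; simpl; [reflexivity|]. now rewrite IHk. Qed.

Lemma Cpseries_series (a : nat -> C) (z l : C) :
  Cpseries a z l <-> Cseries (fun k => z ^ k * a k)%C l.
Proof.
split; apply is_series_ext; intros k;
  now rewrite <- pow_n_Cpow.
Qed.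

Lemma Cseries_unique (u : nat -> C) (l1 l2 : C) : Cseries u l1 -> Cseries u l2 -> l1 = l2.
Proof.
apply (filterlim_locally_unique (K := C_AbsRing) (V := C_NormedModule)).
Qed.

Lemma Cseries_norm_le (u : nat -> C) (v : nat -> R) (l : C) (L : R) :
  (forall k, Cmod (u k) <= v k) -> Cseries u l -> is_series v L -> Cmod l <= L.
Proof.
intros H Hu Hv.
assert (S : forall n, Cmod (sum_n (G := C_AbelianMonoid) u n) <= sum_n v n).
{ induction n.
  - rewrite !sum_O. apply H.
  - rewrite !sum_Sn. eapply Rle_trans; [apply Cmod_triangle|].
    apply Rplus_le_compat; auto. }
apply (filterlim_le (F := eventually) (fun n => Cmod (sum_n (G := C_AbelianMonoid) u n)) (sum_n v) (Cmod l) L).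
- exists 0%nat. intros n _. apply S.
- apply filterlim_comp with (2 := filterlim_norm (K := C_AbsRing) (V := C_NormedModule) l).
  exact Hu.
- exact Hv.
Qed.

Lemma Cseries_bounded (u : nat -> C) (l : C) : Cseries u l -> exists M, forall k, Cmod (u k) <= M.
Proof.
intros H.
destruct (filterlim_bounded (K := C_AbsRing) (V := C_NormedModule) (sum_n u)) as [M HM].
{ now exists l. }
exists (M + M). intros [|k].
- specialize (HM 0%nat). rewrite sum_O in HM.
  change (norm (u 0%nat)) with (Cmod (u 0%nat)) in HM.
  pose proof (Cmod_ge_0 (u 0%nat)). lra.
- pose proof (HM (S k)) as H1. pose proof (HM k) as H2.
  rewrite sum_Sn in H1.
  set (s := sum_n u k : C) in *.
  change (Cmod (s + u (S k))%C <= M) in H1. change (Cmod s <= M) in H2.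
  pose proof (Cmod_triangle (s + u (S k)) (- s)) as T.
  rewrite Cmod_opp in T.
  replace (s + u (S k) + - s)%C with (u (S k) : C) in T by ring. lra.
Qed.

(** Radii of convergence are defined for real series.  This lemma allows the
    moduli of complex coefficients to be treated by that theory: the terms of a
    convergent series are bounded, which gives a geometric majorant at every
    smaller radius. *)
Lemma expansion_lt_CV_radius h a r :
  has_expansion h a -> Rabs r < 1 ->
  Rbar_lt (Rabs r) (CV_radius (fun k => Cmod (a k))).
Proof.
intros H Hr.
set (x := (Rabs r + 1) / 2). set (y := (x + 1) / 2).
assert (Hx : Rabs r < x < 1) by (unfold x; lra).
assert (Hy : x < y < 1) by (unfold y; lra).
pose proof (Rabs_pos r).
apply Rbar_lt_le_trans with (Finite x); [simpl; lra|].
destruct (Lub_Rbar_correct (CV_disk (fun k => Cmod (a k)))) as [ub _].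
apply ub. unfold CV_disk.
assert (Dy : unit_disk (RtoC y)).
{ unfold unit_disk. rewrite Cmod_R, Rabs_pos_eq; lra. }
destruct (Cseries_bounded _ _ (proj1 (Cpseries_series _ _ _) (H _ Dy))) as [M HM].
apply (ex_series_le (K := R_AbsRing) (V := R_CompleteNormedModule) _ (fun k => M * (x / y) ^ k)).
2:{ apply (ex_series_scal_l (K := R_AbsRing) M (fun k => (x / y) ^ k)). apply ex_series_geom.
    rewrite Rabs_pos_eq. 
    - apply Rlt_div_l; lra.
    - apply Rdiv_le_0_compat; lra. }
intros k. change (norm (Rabs (Cmod (a k) * x ^ k))) with (Rabs (Rabs (Cmod (a k) * x ^ k))).
rewrite Rabs_Rabsolu, Rabs_pos_eq.
2:{ apply Rmult_le_pos; [apply Cmod_ge_0|apply pow_le; lra]. }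
specialize (HM k). rewrite Cmod_mult, Cmod_pow, Cmod_R, Rabs_pos_eq in HM by lra.
replace ((x / y) ^ k) with (x ^ k / y ^ k)
  by (unfold Rdiv; rewrite Rpow_mult_distr, pow_inv; reflexivity).
pose proof (pow_lt x k ltac:(lra)). pose proof (pow_lt y k ltac:(lra)).
replace (Cmod (a k) * x ^ k) with (y ^ k * Cmod (a k) * (x ^ k / y ^ k)) by (field; lra).
apply Rmult_le_compat_r; auto. apply Rlt_le, Rdiv_lt_0_compat; lra.
Qed.

Definition Cps_derive (a : nat -> C) (k : nat) : C := (INR (S k) * a (S k))%C.

Lemma Cps_derive_norm a k :
  Cmod (Cps_derive a k) = PS_derive (fun j => Cmod (a j)) k.
Proof.
unfold Cps_derive, PS_derive. rewrite Cmod_mult, Cmod_R, Rabs_pos_eq; auto.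
apply pos_INR.
Qed.

Lemma dominated_Cpseries (a : nat -> C) (z : C) :
  Rbar_lt (Cmod z) (CV_radius (fun k => Cmod (a k))) ->
  exists l : C, Cpseries a z l.
Proof.
intros H.
destruct (ex_series_le (K := C_AbsRing) (V := C_CompleteNormedModule)
   (fun k => z ^ k * a k)%C (fun k => Cmod (a k) * Cmod z ^ k)) as [l Hl].
- intros k. change (Cmod (z ^ k * a k)%C <= Cmod (a k) * Cmod z ^ k).
  rewrite Cmod_mult, Cmod_pow. lra.
- assert (K := CV_radius_inside (fun k => Cmod (a k)) (Cmod z)).
  rewrite Rabs_pos_eq in K by apply Cmod_ge_0. specialize (K H).
  revert K. apply ex_series_ext. intros k.
  change (pow_n (K := R_Ring) (Cmod z) k * Cmod (a k) = Cmod (a k) * Cmod z ^ k).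
  rewrite pow_n_pow. ring.
- exists l. now apply Cpseries_series.
Qed.

(** The factor [(k + 1) (k + 2) r ^ k] is the general term of a second derivative,
    so that the sum of these bounds converges wherever the series does. *)
Lemma pow_taylor_bound z w r k :
  Cmod z <= r -> Cmod w <= r ->
  Cmod (w ^ S (S k) - z ^ S (S k) - (w - z) * (INR (S (S k)) * z ^ S k))%C
  <= INR (S k) * INR (S (S k)) * r ^ k * Cmod (w - z) ^ 2.
Proof.
intros Hz Hw.
pose proof (Cmod_ge_0 z) as Z0. pose proof (Cmod_ge_0 (w - z)) as D0.
induction k.
- replace (w ^ 2 - z ^ 2 - (w - z) * (INR 2 * z ^ 1))%C with ((w - z) ^ 2)%C
    by (simpl INR; rewrite RtoC_plus; ring).
  rewrite Cmod_pow. simpl INR. nra.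
- replace (w ^ S (S (S k)) - z ^ S (S (S k)) - (w - z) * (INR (S (S (S k))) * z ^ S (S k)))%C
    with (w * (w ^ S (S k) - z ^ S (S k) - (w - z) * (INR (S (S k)) * z ^ S k))
          + INR (S (S k)) * z ^ S k * (w - z) ^ 2)%C.
  2:{ rewrite (S_INR (S (S k))), RtoC_plus. simpl Cpow. ring. }
  eapply Rle_trans; [apply Cmod_triangle|].
  rewrite !Cmod_mult, !Cmod_pow, Cmod_R, (Rabs_pos_eq (INR _)) by apply pos_INR.
  set (E := Cmod (w ^ S (S k) - z ^ S (S k) - (w - z) * (INR (S (S k)) * z ^ S k))%C) in *.
  assert (P : Cmod z ^ S k <= r ^ S k) by (apply pow_incr; lra).
  assert (E0 : 0 <= E) by apply Cmod_ge_0.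
  assert (R0 : 0 <= r ^ k) by (apply pow_le; lra).
  set (d := Cmod (w - z)) in *.
  assert (T1 : Cmod w * E <= r * (INR (S k) * INR (S (S k)) * r ^ k * d ^ 2)).
  { apply Rmult_le_compat; auto. apply Cmod_ge_0. }
  assert (N : 0 <= INR (S (S k))) by apply pos_INR.
  assert (T2 : INR (S (S k)) * Cmod z ^ S k * d ^ 2 <= INR (S (S k)) * r ^ S k * d ^ 2).
  { apply Rmult_le_compat_r; [nra|]. now apply Rmult_le_compat_l. }
  eapply Rle_trans; [apply Rplus_le_compat; eassumption|].
  rewrite (S_INR (S (S k))). rewrite (S_INR (S k)) in *. simpl pow.
  assert (0 <= (INR (S k) + 1) * (r * r ^ k) * (d * (d * 1))).
  { apply Rmult_le_pos; [apply Rmult_le_pos; [lra|apply Rmult_le_pos; lra]|nra]. }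
  nra.
Qed.

Lemma Cseries_shift (u : nat -> C) (l : C) :
  Cseries u l -> Cseries (fun k => u (S k)) (l - u 0%nat)%C.
Proof.
intros H. apply (is_series_incr_1 (K := C_AbsRing) (V := C_NormedModule)).
change (Cseries u ((l - u 0%nat) + u 0%nat)%C).
now replace ((l - u 0%nat) + u 0%nat)%C with l by ring.
Qed.

Lemma Cseries_unshift (u : nat -> C) (l : C) :
  Cseries (fun k => u (S k)) l -> Cseries u (l + u 0%nat)%C.
Proof.
intros H. apply (is_series_decr_1 (K := C_AbsRing) (V := C_NormedModule)).
change (Cseries (fun k => u (S k)) ((l + u 0%nat) + - u 0%nat)%C).
now replace ((l + u 0%nat) + - u 0%nat)%C with l by ring.
Qed.

Lemma Cseries_scal (c : C) (u : nat -> C) (l : C) :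
  Cseries u l -> Cseries (fun k => c * u k)%C (c * l)%C.
Proof. apply (is_series_scal (K := C_AbsRing) (V := C_NormedModule)). Qed.

Lemma Cseries_minus (u v : nat -> C) (l m : C) :
  Cseries u l -> Cseries v m -> Cseries (fun k => u k - v k)%C (l - m)%C.
Proof. apply (is_series_minus (K := C_AbsRing) (V := C_NormedModule)). Qed.

Lemma Cseries_ext (u v : nat -> C) (l : C) :
  (forall k, u k = v k) -> Cseries u l -> Cseries v l.
Proof. apply (is_series_ext (K := C_AbsRing) (V := C_NormedModule)). Qed.

(** Summing [pow_taylor_bound] against the coefficients gives a remainder of the
    order of the square of [w - z]. *)
Lemma expansion_deriv_at h a z :
  has_expansion h a -> unit_disk z ->
  exists l : C, Cpseries (Cps_derive a) z l /\ Cderiv h z l.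
Proof.
intros H Hz.
pose proof (Cmod_ge_0 z) as Z0. unfold unit_disk in Hz.
assert (R1 : CV_radius (fun k => Cmod (Cps_derive a k)) = CV_radius (fun k => Cmod (a k))).
{ rewrite <- (CV_radius_derive (fun k => Cmod (a k))). apply CV_radius_ext. apply Cps_derive_norm. }
destruct (dominated_Cpseries (Cps_derive a) z) as [l Hl].
{ rewrite R1. rewrite <- (Rabs_pos_eq (Cmod z)) by auto.
  apply (expansion_lt_CV_radius h); auto. now rewrite Rabs_pos_eq. }
exists l. split; auto.
set (r := (Cmod z + 1) / 2).
assert (Hr : Cmod z < r < 1) by (unfold r; lra).
set (c := PS_derive (PS_derive (fun k => Cmod (a k)))).
assert (Sc : is_series (fun k => c k * r ^ k) (PSeries c r)).
{ apply is_pseries_R. apply PSeries_correct. apply CV_radius_inside.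
  unfold c. rewrite !CV_radius_derive. apply (expansion_lt_CV_radius h); auto.
  rewrite Rabs_pos_eq; lra. }
assert (c0 : forall k, 0 <= c k).
{ intros k. unfold c, PS_derive. 
  apply Rmult_le_pos; [apply pos_INR|apply Rmult_le_pos; [apply pos_INR|apply Cmod_ge_0]]. }
set (M := PSeries c r) in *.
assert (Quad : forall w, Cmod w <= r ->
   Cmod (h w - h z - (w - z) * l)%C <= Cmod (w - z) ^ 2 * M).
{ intros w Hw.
  assert (Sw := proj1 (Cpseries_series _ _ _) (H w ltac:(unfold unit_disk; lra))).
  assert (Sz := proj1 (Cpseries_series _ _ _) (H z Hz)).
  assert (Sl := proj1 (Cpseries_series _ _ _) Hl).
  do 2 apply Cseries_shift in Sw. do 2 apply Cseries_shift in Sz.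
  apply Cseries_shift in Sl. apply (Cseries_scal (w - z)) in Sl.
  assert (SE := Cseries_minus _ _ _ _ (Cseries_minus _ _ _ _ Sw Sz) Sl).
  eapply (Cseries_norm_le _ (fun k => Cmod (w - z) ^ 2 * (c k * r ^ k))).
  3:{ exact (is_series_scal_l (K := R_AbsRing) (Cmod (w - z) ^ 2) _ _ Sc). }
  2:{ match type of SE with is_series ?u ?s =>
        replace (h w - h z - (w - z) * l)%C with (s : C); [exact SE|] end.
      unfold Cps_derive. simpl. ring. }
  intros k. cbv beta.
  match goal with |- Cmod ?x <= _ => replace x with
    ((w ^ S (S k) - z ^ S (S k) - (w - z) * (INR (S (S k)) * z ^ S k)) * a (S (S k)))%C end.
  2:{ unfold Cps_derive. ring. }
  rewrite Cmod_mult.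
  eapply Rle_trans.
  { apply Rmult_le_compat_r; [apply Cmod_ge_0|]. apply (pow_taylor_bound z w r k); lra. }
  unfold c, PS_derive. apply Req_le. ring. }
(* The remainder estimate itself, at the point [w = r], shows [M >= 0]. *)
assert (M0 : 0 <= M).
{ specialize (Quad (RtoC r)). rewrite Cmod_R, Rabs_pos_eq in Quad by lra.
  specialize (Quad (Rle_refl _)).
  assert (0 < Cmod (r - z)).
  { apply Cmod_gt_0. intros E. 
    assert (E' : RtoC r = z) by (rewrite <- (Cplus_0_l z), <- E; ring).
    rewrite <- E', Cmod_R in Hr. pose proof (Rle_abs r). lra. }
  pose proof (Cmod_ge_0 (h r - h z - (r - z) * l)).
  apply Rnot_lt_le. intros Hn. 
  assert (0 < Cmod (r - z) ^ 2) by now apply pow_lt. nra. }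
apply Cderiv_iff_eps. intros eps He.
exists (Rmin (r - Cmod z) (eps / (M + 1))). split.
{ apply Rmin_pos; [lra|]. apply Rdiv_lt_0_compat; lra. }
intros w Hw.
assert (W1 := Rlt_le_trans _ _ _ Hw (Rmin_l _ _)).
assert (W2 := Rlt_le_trans _ _ _ Hw (Rmin_r _ _)).
eapply Rle_trans.
{ apply Quad. replace w with ((w - z) + z)%C by ring.
  pose proof (Cmod_triangle (w - z) z). lra. }
apply Rlt_div_r in W2; [|lra]. pose proof (Cmod_ge_0 (w - z)). nra.
Qed.

Lemma expansion_Cderiv h a z :
  has_expansion h a -> unit_disk z -> Cderiv h z (C_derive h z).
Proof.
intros H Hz. destruct (expansion_deriv_at h a z H Hz) as [l [_ D]].
now rewrite (is_C_derive_unique _ _ _ D).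
Qed.

Lemma expansion_derive h a :
  has_expansion h a -> has_expansion (C_derive h) (Cps_derive a).
Proof.
intros H z Hz. destruct (expansion_deriv_at h a z H Hz) as [l [S D]].
now rewrite (is_C_derive_unique _ _ _ D).
Qed.

(** The derived series of the zero function again represents zero; its
    coefficients are, up to positive factors, the shifted ones. *)
Lemma zero_expansion k : forall a, has_expansion (fun _ => RtoC 0) a -> a k = RtoC 0.
Proof.
induction k; intros a H.
- assert (H0 := H (RtoC 0) ltac:(unfold unit_disk; rewrite Cmod_0; lra)).
  symmetry. refine (Cseries_unique _ _ _ H0 _).
  exact (is_pseries_0 (K := C_AbsRing) (V := C_NormedModule) a).
- assert (K : Cps_derive a k = RtoC 0).
  { apply IHk. intros z Hz.
    assert (D := expansion_derive _ _ H z Hz).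
    rewrite (is_C_derive_unique (fun _ : C => RtoC 0) z _ (Cderiv_const (RtoC 0) z)) in D.
    exact D. }
  unfold Cps_derive in K.
  apply (f_equal Cmod) in K. rewrite Cmod_mult, Cmod_R, Cmod_0 in K.
  apply Cmod_eq_0. apply Rmult_integral in K. destruct K as [K|K]; auto.
  exfalso. revert K. apply Rabs_no_R0. now apply not_0_INR.
Qed.

Lemma expansion_coef_unique h a b :
  has_expansion h a -> has_expansion h b -> forall k, a k = b k.
Proof.
intros Ha Hb k.
assert (K : (a k - b k)%C = RtoC 0).
{ apply (zero_expansion k (fun k => a k - b k)%C). intros z Hz.
  apply Cpseries_series.
  replace (RtoC 0) with (h z - h z)%C by ring.
  refine (Cseries_ext _ _ _ _ (Cseries_minus _ _ _ _
    (proj1 (Cpseries_series _ _ _) (Ha z Hz)) (proj1 (Cpseries_series _ _ _) (Hb z Hz)))).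
  intros j. simpl. ring. }
rewrite <- (Cplus_0_l (b k)), <- K. ring.
Qed.

(** * The mean value property *)

Notation Ccontinuous_on T := (continuous (T := T) (U := C_UniformSpace)).
Notation Ccontinuous := (Ccontinuous_on C_UniformSpace).
Notation RxR := (prod_UniformSpace R_UniformSpace R_UniformSpace).

Lemma Ccontinuous_ring {T : UniformSpace} (f : T -> C) z :
  Ccontinuous_on T f z <-> continuous (T := T) (U := AbsRing_UniformSpace C_AbsRing) f z.
Proof. split; intros H P HP; apply H, locally_C, HP. Qed.

Lemma Ccontinuous_plus {T : UniformSpace} (f g : T -> C) z :
  Ccontinuous_on T f z -> Ccontinuous_on T g z -> Ccontinuous_on T (fun w => f w + g w)%C z.
Proof.
exact (continuous_plus (K := C_AbsRing) (V := C_NormedModule) f g z).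
Qed.

Lemma Ccontinuous_mult {T : UniformSpace} (f g : T -> C) z :
  Ccontinuous_on T f z -> Ccontinuous_on T g z -> Ccontinuous_on T (fun w => f w * g w)%C z.
Proof.
intros Hf Hg. apply Ccontinuous_ring.
apply (continuous_mult (U := T) (K := C_AbsRing)); now apply Ccontinuous_ring.
Qed.

Lemma Ccontinuous_pair {T : UniformSpace} (x y : T -> R) p :
  continuous x p -> continuous y p -> Ccontinuous_on T (fun q => (x q, y q)) p.
Proof.
intros Hx Hy. apply (continuous_comp_2 x y (fun a b => (a, b) : C)); auto.
eapply continuous_ext; [|apply continuous_id]. now intros [a b].
Qed.

(** Continuity of the derivative is what differentiation under the integral sign
    requires; in contrast to having an expansion, it is obviously stable under
    quotients. *)
Definition C1_disk (F : C -> C) : Prop :=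
  exists F' : C -> C, forall z, unit_disk z -> Cderiv F z (F' z) /\ Ccontinuous F' z.

Lemma C1_const c : C1_disk (fun _ => c).
Proof.
exists (fun _ => RtoC 0). intros z Hz. split; [apply Cderiv_const|].
apply continuous_const.
Qed.

Lemma C1_id : C1_disk (fun z => z).
Proof.
exists (fun _ => RtoC 1). intros z Hz. split; [apply Cderiv_id|].
apply continuous_const.
Qed.

Lemma C1_plus F G : C1_disk F -> C1_disk G -> C1_disk (fun z => F z + G z)%C.
Proof.
intros [F' HF] [G' HG]. exists (fun z => F' z + G' z)%C.
intros z Hz. destruct (HF z Hz), (HG z Hz).
split; [now apply Cderiv_plus|now apply Ccontinuous_plus].
Qed.

Lemma C1_mult F G : C1_disk F -> C1_disk G -> C1_disk (fun z => F z * G z)%C.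
Proof.
intros [F' HF] [G' HG]. exists (fun z => F' z * G z + F z * G' z)%C.
intros z Hz. destruct (HF z Hz), (HG z Hz).
split; [now apply Cderiv_mult|].
apply Ccontinuous_plus; apply Ccontinuous_mult; auto; eapply Cderiv_continuous; eassumption.
Qed.

Lemma C1_pow n : C1_disk (fun z => z ^ n)%C.
Proof. induction n; [exact (C1_const (RtoC 1))|]. now apply C1_mult; [apply C1_id|]. Qed.

Lemma C1_inv F :
  C1_disk F -> (forall z, unit_disk z -> F z <> RtoC 0) -> C1_disk (fun z => / F z)%C.
Proof.
intros [F' HF] N. exists (fun z => F' z * - (/ F z * / F z))%C.
intros z Hz. destruct (HF z Hz) as [D Cn].
assert (D2 := Cderiv_comp Cinv F z _ _ (Cderiv_inv _ (N z Hz)) D).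
split.
{ replace (/ F z * / F z)%C with (/ (F z * F z))%C; [exact D2|].
  field. now apply N. }
apply Ccontinuous_mult; auto.
assert (K := Cderiv_continuous _ _ _ D2).
apply (continuous_opp (K := C_AbsRing) (V := C_NormedModule)).
now apply Ccontinuous_mult.
Qed.

Lemma C1_expansion F a : has_expansion F a -> C1_disk F.
Proof.
intros H. exists (C_derive F). intros z Hz. split; [now apply (expansion_Cderiv F a)|].
apply (Cderiv_continuous _ _ _ (expansion_Cderiv _ _ z (expansion_derive _ _ H) Hz)).
Qed.

Definition cis (t : R) : C := (cos t, sin t).

Lemma Cmod_cis t : Cmod (cis t) = 1.
Proof.
unfold Cmod, cis. transitivity (sqrt 1); [|apply sqrt_1]. f_equal. simpl.
pose proof (sin2_cos2 t). unfold Rsqr in H. lra.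
Qed.

Lemma Cmod_circle (r t : R) : Cmod (r * cis t)%C = Rabs r.
Proof. rewrite Cmod_mult, Cmod_cis, Cmod_R. ring. Qed.

Lemma curve_radius (r t : R) : curve_deriv (fun u => u * cis t)%C r (cis t).
Proof.
split; unfold cis, Cmult, RtoC; simpl; auto_derive; auto; ring.
Qed.

Lemma curve_circle (r t : R) : curve_deriv (fun u => r * cis u)%C t (r * (Ci * cis t))%C.
Proof.
split; unfold cis, Cmult, RtoC, Ci; simpl; auto_derive; auto; ring.
Qed.

Section MeanValue.

Variables F F' : C -> C.
Hypothesis HF : forall z, unit_disk z -> Cderiv F z (F' z) /\ Ccontinuous F' z.

Lemma circle_in_disk (r t : R) : Rabs r < 1 -> unit_disk (r * cis t)%C.
Proof. intros H. unfold unit_disk. now rewrite Cmod_circle. Qed.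

Lemma circle_deriv_radius (r t : R) : Rabs r < 1 ->
  is_derive (fun u : R => fst (F (u * cis t))%C) r (fst (cis t * F' (r * cis t))%C).
Proof.
intros Hr.
apply (curve_deriv_comp F (fun u => u * cis t)%C r _ _ (proj1 (HF _ (circle_in_disk r t Hr))) (curve_radius r t)).
Qed.

Lemma circle_deriv_angle (r t : R) : Rabs r < 1 ->
  curve_deriv (fun u => F (r * cis u))%C t (r * (Ci * cis t) * F' (r * cis t))%C.
Proof.
intros Hr.
apply (curve_deriv_comp F (fun u => r * cis u)%C t _ _ (proj1 (HF _ (circle_in_disk r t Hr))) (curve_circle r t)).
Qed.

Lemma circle_deriv_radius_continuous (r t : R) : Rabs r < 1 ->
  filterlim (fun p : R * R => fst (cis (snd p) * F' (fst p * cis (snd p)))%C)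
    (locally (r, t)) (locally (fst (cis t * F' (r * cis t))%C)).
Proof.
intros Hr.
assert (Kcis : Ccontinuous_on RxR (fun p : RxR => cis (snd p)) (r, t)).
{ apply Ccontinuous_pair.
  - apply (continuous_comp (snd : RxR -> R) cos); [apply continuous_snd|apply continuous_cos].
  - apply (continuous_comp (snd : RxR -> R) sin); [apply continuous_snd|apply continuous_sin]. }
assert (Kr : Ccontinuous_on RxR (fun p : RxR => RtoC (fst p)) (r, t)).
{ apply Ccontinuous_pair; [apply continuous_fst|apply continuous_const]. }
apply (continuous_comp (fun p : RxR => cis (snd p) * F' (fst p * cis (snd p)))%C (fst : C -> R) (r, t)).
2: apply continuous_fst.
apply Ccontinuous_mult; [exact Kcis|].
apply (continuous_comp (fun p : RxR => fst p * cis (snd p))%C F').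
- now apply Ccontinuous_mult.
- apply HF. now apply circle_in_disk.
Qed.

Lemma locally_Rabs_lt (r : R) : Rabs r < 1 -> locally r (fun u => Rabs u < 1).
Proof.
intros H. exists (mkposreal (1 - Rabs r) ltac:(lra)). intros u Hu.
change (Rabs (u - r) < 1 - Rabs r) in Hu.
replace u with ((u - r) + r) by ring. pose proof (Rabs_triang (u - r) r). lra.
Qed.

Lemma circle_mean_deriv (r : R) : Rabs r < 1 ->
  is_derive (fun u : R => RInt (fun t => fst (F (u * cis t)%C)) 0 (2 * PI)) r
    (RInt (fun t => fst (cis t * F' (r * cis t))%C) 0 (2 * PI)).
Proof.
intros Hr.
replace (RInt (fun t => fst (cis t * F' (r * cis t))%C) 0 (2 * PI))
  with (RInt (fun t => Derive (fun u : R => fst (F (u * cis t)%C)) r) 0 (2 * PI)).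
2:{ apply RInt_ext. intros t _. apply is_derive_unique. now apply circle_deriv_radius. }
apply (is_derive_RInt_param (fun u t : R => fst (F (u * cis t)%C))).
- apply (filter_imp (fun u : R => Rabs u < 1)); [|now apply locally_Rabs_lt].
  intros u Hu t _. eexists. now apply circle_deriv_radius.
- intros t _. apply continuity_2d_pt_ext_loc with (fun u v : R => fst (cis v * F' (u * cis v))%C).
  + destruct (locally_Rabs_lt r Hr) as [d Hd]. exists d. intros u v Hu Hv.
    symmetry. apply is_derive_unique. apply circle_deriv_radius. now apply Hd.
  + apply continuity_2d_pt_filterlim. now apply circle_deriv_radius_continuous.
- apply (filter_imp (fun u : R => Rabs u < 1)); [|now apply locally_Rabs_lt].
  intros u Hu. apply (ex_RInt_continuous (V := R_CompleteNormedModule)). intros t _.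
  apply (ex_derive_continuous (K := R_AbsRing) (V := R_NormedModule)).
  eexists. apply (proj1 (circle_deriv_angle u t Hu)).
Qed.

Lemma cis_period : cis (2 * PI) = cis 0.
Proof. unfold cis. now rewrite cos_2PI, sin_2PI, cos_0, sin_0. Qed.

(** Multiplied by [r], the integrand is the derivative with respect to the angle of
    the imaginary part of [F] on the circle. *)
Lemma circle_mean_deriv_0 (r : R) : Rabs r < 1 -> r <> 0 ->
  RInt (fun t => fst (cis t * F' (r * cis t))%C) 0 (2 * PI) = 0.
Proof.
intros Hr Hr0.
apply is_RInt_unique.
assert (K : is_RInt (fun t => r * fst (cis t * F' (r * cis t))%C) 0 (2 * PI) 0).
{ replace 0 with (minus (snd (F (r * cis (2 * PI))%C)) (snd (F (r * cis 0)%C))) at 2.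
  2:{ rewrite cis_period. apply (minus_eq_zero (G := R_AbelianGroup)). }
  apply (is_RInt_derive (V := R_CompleteNormedModule) (fun t => snd (F (r * cis t)%C))).
  - intros t _.
    replace (r * fst (cis t * F' (r * cis t))%C)
      with (snd (r * (Ci * cis t) * F' (r * cis t))%C)
      by (unfold Ci, RtoC, Cmult; simpl; ring).
    apply (proj2 (circle_deriv_angle r t Hr)).
  - intros t _.
    apply (continuous_comp (fun v => (r, v) : RxR)
      (fun p : RxR => r * fst (cis (snd p) * F' (fst p * cis (snd p)))%C)).
    + apply (Ccontinuous_pair (T := R_UniformSpace) (fun _ => r) (fun v => v));
        [apply continuous_const|apply continuous_id].
    + apply (continuous_scal_r (K := R_AbsRing) (V := R_NormedModule)).
      now apply circle_deriv_radius_continuous. }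
apply (is_RInt_scal (V := R_NormedModule) _ _ _ (/ r)) in K.
change (is_RInt (fun t => / r * (r * fst (cis t * F' (r * cis t))%C)) 0 (2 * PI) (/ r * 0)) in K.
rewrite Rmult_0_r in K.
revert K. apply is_RInt_ext. intros t _.
eqR. field. auto.
Qed.

Lemma mean_value (r : R) : 0 < r < 1 ->
  is_RInt (fun t => fst (F (r * cis t)%C)) 0 (2 * PI) (2 * PI * fst (F 0)).
Proof.
intros Hr.
set (I := fun u : R => RInt (fun t => fst (F (u * cis t)%C)) 0 (2 * PI)).
assert (I0 : I 0 = 2 * PI * fst (F 0)).
{ unfold I. rewrite (RInt_ext _ (fun _ => fst (F 0))).
  - rewrite RInt_const. unfold scal; simpl; unfold mult; simpl. ring.
  - intros t _. now rewrite Cmult_0_l. }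
assert (Ir : I r = I 0).
{ destruct (MVT_cor2 I (fun u : R => RInt (fun t => fst (cis t * F' (u * cis t))%C) 0 (2 * PI)) 0 r)
    as [c [Hc1 Hc2]].
  - lra.
  - intros c Hc. apply is_derive_Reals, circle_mean_deriv. rewrite Rabs_pos_eq; lra.
  - rewrite circle_mean_deriv_0 in Hc1; [lra| |lra]. rewrite Rabs_pos_eq; lra. }
rewrite <- I0, <- Ir. apply (RInt_correct (V := R_CompleteNormedModule)).
apply (ex_RInt_continuous (V := R_CompleteNormedModule)). intros t _.
apply (ex_derive_continuous (K := R_AbsRing) (V := R_NormedModule)).
eexists. refine (proj1 (circle_deriv_angle r t _)). rewrite Rabs_pos_eq; lra.
Qed.

End MeanValue.

(** * Parseval's identity and Clunie's inequality *)

Definition Cpoly (p : nat -> C) (m : nat) (z : C) : C :=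
  sum_n (G := C_AbelianMonoid) (fun k => p k * z ^ k)%C m.

Lemma Cpoly_0 p z : Cpoly p 0 z = p 0%nat.
Proof. unfold Cpoly. rewrite sum_O. simpl. ring. Qed.

Lemma Cpoly_S p m z : Cpoly p (S m) z = (Cpoly p m z + p (S m) * z ^ S m)%C.
Proof. unfold Cpoly. now rewrite sum_Sn. Qed.

Lemma conj_pow_circle (r t : R) j N : (j <= N)%nat ->
  (Cconj ((r * cis t) ^ j) * (r * cis t) ^ N = (r ^ (2 * j))%R * (r * cis t) ^ (N - j))%C.
Proof.
intros H. set (z := (r * cis t)%C).
replace N with (j + (N - j))%nat at 1 by lia.
rewrite Cpow_add_r, Cmult_assoc. f_equal.
rewrite Cpow_conj, <- Cpow_mult_l, (Cmult_comm _ z), <- Cmod2_conj.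
unfold z. rewrite Cmod_circle, <- RtoC_pow. f_equal.
now rewrite pow2_abs, pow_mult.
Qed.

Lemma is_RInt_plus_R (f g : R -> R) (a b x y : R) :
  is_RInt f a b x -> is_RInt g a b y -> is_RInt (fun t => f t + g t) a b (x + y).
Proof. apply (is_RInt_plus (V := R_NormedModule)). Qed.

Lemma is_RInt_scal_R (f : R -> R) (a b k x : R) :
  is_RInt f a b x -> is_RInt (fun t => k * f t) a b (k * x).
Proof. apply (is_RInt_scal (V := R_NormedModule)). Qed.

(** On the circle of radius [r], [conj (z ^ j) z ^ N = r ^ (2 j) z ^ (N - j)], so
    the integrand is the real part of a function that vanishes at the origin. *)
Lemma circle_cross_term p m N T (r : R) :
  (m < N)%nat -> C1_disk T -> 0 < r < 1 ->
  is_RInt (fun t => Re (Cconj (Cpoly p m (r * cis t)) * ((r * cis t) ^ N * T (r * cis t))%C))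
    0 (2 * PI) 0.
Proof.
intros Hm HT Hr.
assert (mono : forall j, (j <= m)%nat ->
  is_RInt (fun t => Re (Cconj (p j * (r * cis t) ^ j) * ((r * cis t) ^ N * T (r * cis t)))%C)
    0 (2 * PI) 0).
{ intros j Hj.
  assert (C1F : C1_disk (fun z => (Cconj (p j) * (r ^ (2 * j))%R) * (z ^ (N - j) * T z))%C).
  { apply C1_mult; [apply C1_const|]. apply C1_mult; [apply C1_pow|exact HT]. }
  destruct C1F as [F' HF].
  assert (K := mean_value _ F' HF r Hr). cbv beta in K.
  replace (0 ^ (N - j))%C with (RtoC 0) in K.
  2:{ destruct (N - j)%nat eqn:E; [lia|]. simpl. ring. }
  replace ((Cconj (p j) * (r ^ (2 * j))%R) * (0 * T 0))%C with (RtoC 0) in K by ring.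
  change (fst (RtoC 0)) with 0 in K. replace (2 * PI * 0) with 0 in K by ring.
  revert K. apply is_RInt_ext. intros t _.
  change fst with Re. f_equal.
  rewrite Cmult_conj.
  transitivity (Cconj (p j) * (Cconj ((r * cis t) ^ j) * (r * cis t) ^ N) * T (r * cis t))%C; [|ring].
  rewrite conj_pow_circle by lia. ring. }
assert (K : forall i, (i <= m)%nat ->
  is_RInt (fun t => Re (Cconj (Cpoly p i (r * cis t)) * ((r * cis t) ^ N * T (r * cis t)))%C)
    0 (2 * PI) 0).
{ induction i; intros Hi.
  - generalize (mono 0%nat Hi). apply is_RInt_ext. intros t _.
    rewrite Cpoly_0. simpl. do 3 f_equal; ring.
  - assert (G := is_RInt_plus_R _ _ _ _ _ _ (IHi ltac:(lia)) (mono _ Hi)).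
    replace 0 with (0 + 0) at 2 by ring.
    revert G. apply is_RInt_ext. intros t _.
    rewrite Cpoly_S, Cplus_conj, Cmult_plus_distr_r. reflexivity. }
now apply K.
Qed.

Lemma Cmod2_plus (a b : C) :
  Cmod (a + b)%C ^ 2 = Cmod a ^ 2 + Cmod b ^ 2 + 2 * Re (Cconj a * b)%C.
Proof. rewrite !Cmod2_alt. destruct a, b; unfold Cconj; simpl. ring. Qed.

Lemma circle_parseval p m (r : R) : 0 < r < 1 ->
  is_RInt (fun t => Cmod (Cpoly p m (r * cis t)) ^ 2) 0 (2 * PI)
    (2 * PI * sum_n (fun k => Cmod (p k) ^ 2 * r ^ (2 * k)) m).
Proof.
intros Hr. 
assert (cst : forall c, is_RInt (fun _ => c) 0 (2 * PI) (2 * PI * c)).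
{ intros c. replace (2 * PI * c) with ((2 * PI - 0) * c) by ring.
  apply (is_RInt_const (V := R_NormedModule)). }
induction m.
- rewrite sum_O. generalize (cst (Cmod (p 0%nat) ^ 2 * r ^ (2 * 0))).
  apply is_RInt_ext. intros t _. rewrite Cpoly_0. simpl. 
  eqR. ring.
- assert (X := circle_cross_term p m (S m) (fun _ => p (S m)) r ltac:(lia) (C1_const _) Hr).
  apply (is_RInt_scal_R _ _ _ 2) in X.
  assert (Y := is_RInt_plus_R _ _ _ _ _ _
    (is_RInt_plus_R _ _ _ _ _ _ IHm (cst (Cmod (p (S m)) ^ 2 * r ^ (2 * S m)))) X).
  replace (2 * PI * sum_n (fun k => Cmod (p k) ^ 2 * r ^ (2 * k)) (S m))
    with (2 * PI * sum_n (fun k => Cmod (p k) ^ 2 * r ^ (2 * k)) m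
          + 2 * PI * (Cmod (p (S m)) ^ 2 * r ^ (2 * S m)) + 2 * 0).
  2:{ rewrite sum_Sn. change plus with Rplus. ring. }
  revert Y. apply is_RInt_ext. intros t _.
  rewrite Cpoly_S, Cmod2_plus.
  rewrite Cmod_mult, Cmod_pow, Cmod_circle, Rabs_pos_eq by lra.
  now rewrite Rpow_mult_distr, <- pow_mult, (Nat.mul_comm (S m)), (Cmult_comm (p (S m))).
Qed.

Lemma expansion_quotient F a : has_expansion F a ->
  exists G, has_expansion G (fun k => a (S k)) /\
    forall z, unit_disk z -> F z = (a 0%nat + z * G z)%C.
Proof.
intros H.
(* The value [a 1] at the origin is the one that makes the quotient continuous. *)
exists (fun z => if Req_EM_T (Cmod z) 0 then a 1%nat else ((F z - a 0%nat) / z)%C).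
split; intros z Hz; destruct (Req_EM_T (Cmod z) 0) as [E|E].
- apply Cmod_eq_0 in E. rewrite E.
  exact (is_pseries_0 (K := C_AbsRing) (V := C_NormedModule) (fun k => a (S k))).
- assert (Nz : z <> RtoC 0) by (intros ->; now rewrite Cmod_0 in E).
  apply Cpseries_series.
  assert (K := Cseries_scal (/ z) _ _ (Cseries_shift _ _ (proj1 (Cpseries_series _ _ _) (H z Hz)))).
  replace ((F z - a 0%nat) / z)%C with (/ z * (F z - z ^ 0 * a 0%nat))%C by (simpl; field; auto).
  revert K. apply Cseries_ext. intros k. simpl. field; auto.
- apply Cmod_eq_0 in E. rewrite E, Cmult_0_l, Cplus_0_r.
  refine (Cseries_unique _ _ _ (H (RtoC 0) _) _).
  + unfold unit_disk. rewrite Cmod_0. lra.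
  + exact (is_pseries_0 (K := C_AbsRing) (V := C_NormedModule) a).
- assert (Nz : z <> RtoC 0) by (intros ->; now rewrite Cmod_0 in E).
  field; auto.
Qed.

(** The remainder after a Taylor polynomial is again a power of [z] times a sum of
    a power series in the whole disk. *)
Lemma expansion_tail F a m : has_expansion F a ->
  exists G, has_expansion G (fun k => a (S m + k)%nat) /\
    forall z, unit_disk z -> F z = (Cpoly a m z + z ^ S m * G z)%C.
Proof.
intros H. induction m.
- destruct (expansion_quotient F a H) as [G [HG E]].
  exists G. split; [exact HG|]. intros z Hz. rewrite E, Cpoly_0 by auto. simpl. ring.
- destruct IHm as [G [HG E]].
  destruct (expansion_quotient G _ HG) as [G' [HG' E']].
  exists G'. split.
  + intros z Hz. generalize (HG' z Hz). apply is_pseries_ext.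
    intros k. f_equal. lia.
  + intros z Hz. rewrite E, E', Cpoly_S by auto. rewrite Nat.add_0_r.
    simpl. ring.
Qed.

(** Let [P] and [Q] be the Taylor polynomials of degree [m + 1] of [A] and of
    degree [m] of [B].  Since [A] vanishes at the origin, [B P - A Q] is divisible
    by [z ^ (m + 2)], that is, [(A / B) Q = P + z ^ (m + 2) T].  The two terms on
    the right are orthogonal on circles, and [|A / B| <= 1], so the mean square of
    [P] is at most that of [Q]. *)
Lemma clunie_inequality A B a b m (r : R) :
  has_expansion A a -> has_expansion B b -> a 0%nat = RtoC 0 ->
  (forall z, unit_disk z -> Cmod (A z) <= Cmod (B z)) ->
  (forall z, unit_disk z -> B z <> RtoC 0) ->
  0 < r < 1 ->
  sum_n (fun k => Cmod (a k) ^ 2 * r ^ (2 * k)) (S m)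
  <= sum_n (fun k => Cmod (b k) ^ 2 * r ^ (2 * k)) m.
Proof.
intros HA HB a0 le nz Hr.
destruct (expansion_tail A a 0 HA) as [A1 [HA1 EA1]].
destruct (expansion_tail A a (S m) HA) as [A2 [HA2 EA2]].
destruct (expansion_tail B b m HB) as [B1 [HB1 EB1]].
(* [T] is [- (A1 B1 - B A2) / B], written with sums, products and one inverse. *)
set (T := fun z => (- RtoC 1 * (A1 z * B1 z + - RtoC 1 * (B z * A2 z)) * / B z)%C).
assert (C1T : C1_disk T).
{ pose proof (C1_expansion _ _ HB) as CB.
  apply C1_mult; [|now apply C1_inv].
  apply C1_mult; [apply C1_const|].
  apply C1_plus.
  - apply C1_mult; eapply C1_expansion; eassumption.
  - apply C1_mult; [apply C1_const|].
    apply C1_mult; [exact CB|]. eapply C1_expansion; eassumption. }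
assert (key : forall z, unit_disk z ->
  (A z / B z * Cpoly b m z = Cpoly a (S m) z + z ^ S (S m) * T z)%C).
{ intros z Hz.
  replace (Cpoly b m z) with (B z - z ^ S m * B1 z)%C by (rewrite (EB1 z) by auto; ring).
  replace (Cpoly a (S m) z) with (A z - z ^ S (S m) * A2 z)%C by (rewrite (EA2 z) by auto; ring).
  assert (Az : A z = (z * A1 z)%C) by (rewrite (EA1 z), Cpoly_0, a0 by auto; simpl; ring).
  unfold T. rewrite Az. simpl Cpow. field. now apply nz. }
assert (PA := circle_parseval a (S m) r Hr).
assert (PB := circle_parseval b m r Hr).
assert (X := circle_cross_term a (S m) (S (S m)) T r ltac:(lia) C1T Hr).
apply (is_RInt_scal_R _ _ _ 2) in X.
assert (Y := is_RInt_plus_R _ _ _ _ _ _ PA X).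
assert (pi := PI_RGT_0).
assert (L := is_RInt_le _ _ 0 (2 * PI) _ _ ltac:(lra) Y PB).
apply Rmult_le_reg_l with (2 * PI); [lra|].
rewrite (Rmult_0_r 2), Rplus_0_r in L. apply L.
intros t _.
assert (Hz : unit_disk (r * cis t)%C) by (apply circle_in_disk; rewrite Rabs_pos_eq; lra).
set (z := (r * cis t)%C) in *.
assert (E := key z Hz). apply (f_equal (fun w => Cmod w ^ 2)) in E.
rewrite Cmod2_plus, Cmod_mult, Cmod_div in E by auto.
pose proof (le z Hz). pose proof (proj1 (Cmod_gt_0 _) (nz z Hz)) as Bp.
pose proof (Cmod_ge_0 (A z)) as A0.
assert (Q1 : 0 <= Cmod (A z) / Cmod (B z) <= 1).
{ split; [apply Rdiv_le_0_compat; auto|]. apply Rle_div_l; lra. }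
pose proof (Cmod_ge_0 (Cpoly b m z)) as P0.
pose proof (pow2_ge_0 (Cmod (z ^ S (S m) * T z)%C)).
assert ((Cmod (A z) / Cmod (B z) * Cmod (Cpoly b m z)) ^ 2 <= Cmod (Cpoly b m z) ^ 2).
{ apply pow_incr. nra. }
change (Cmod (Cpoly a (S m) z) ^ 2 + 2 * Re (Cconj (Cpoly a (S m) z) * (z ^ S (S m) * T z))%C
  <= Cmod (Cpoly b m z) ^ 2).
lra.
Qed.

Lemma expansion_scal c F a :
  has_expansion F a -> has_expansion (fun z => c * F z)%C (fun k => c * a k)%C.
Proof.
intros H z Hz. apply Cpseries_series.
generalize (Cseries_scal c _ _ (proj1 (Cpseries_series _ _ _) (H z Hz))).
apply Cseries_ext. intros k. simpl. ring.
Qed.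

Lemma expansion_plus F G a b :
  has_expansion F a -> has_expansion G b ->
  has_expansion (fun z => F z + G z)%C (fun k => a k + b k)%C.
Proof.
intros HF HG z Hz.
apply (is_pseries_plus (K := C_AbsRing) (V := C_NormedModule)); auto.
Qed.

Lemma expansion_ext F G a b :
  (forall z, unit_disk z -> F z = G z) -> (forall k, a k = b k) ->
  has_expansion F a -> has_expansion G b.
Proof.
intros EF Ea H z Hz. rewrite <- EF by auto.
apply (is_pseries_ext (K := C_AbsRing) (V := C_NormedModule) a); auto.
Qed.

(** * The coefficient bounds *)

Definition shift_coef (n : nat) (a : nat -> C) (k : nat) : C :=
  if (k <? n)%nat then RtoC 0 else a (k - n)%nat.

Lemma shift_coef_add n a k : shift_coef n a (k + n) = a k.
Proof.
unfold shift_coef. replace (k + n <? n)%nat with false.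
- f_equal. lia.
- symmetry. apply Nat.ltb_ge. lia.
Qed.

Lemma expansion_mult_id F a :
  has_expansion F a ->
  has_expansion (fun z => z * F z)%C (fun k => match k with O => RtoC 0 | S j => a j end).
Proof.
intros H z Hz. apply Cpseries_series.
replace (z * F z)%C with (z * F z + z ^ 0 * RtoC 0)%C by ring.
apply (Cseries_unshift (fun k => z ^ k * match k with O => RtoC 0 | S j => a j end)%C).
generalize (Cseries_scal z _ _ (proj1 (Cpseries_series _ _ _) (H z Hz))).
apply Cseries_ext. intros k. simpl. ring.
Qed.

Lemma expansion_mult_pow n F a :
  has_expansion F a -> has_expansion (fun z => z ^ n * F z)%C (shift_coef n a).
Proof.
intros H. induction n.
- revert H. apply expansion_ext.
  + intros z _. simpl. ring.
  + intros k. unfold shift_coef. simpl. f_equal. lia.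
- apply expansion_mult_id in IHn. revert IHn. apply expansion_ext.
  + intros z _. simpl. ring.
  + intros [|k]; reflexivity.
Qed.

Lemma expansion_euler F a :
  has_expansion F a -> has_expansion (fun z => z * C_derive F z)%C (fun k => INR k * a k)%C.
Proof.
intros H. generalize (expansion_mult_id _ _ (expansion_derive F a H)).
apply expansion_ext; auto. intros [|k]; [|reflexivity]. simpl. ring.
Qed.

(** Continuity at [1] replaces the weights [r ^ M] by [1]. *)
Lemma le_of_power_scaled K b M :
  (forall r, 0 < r < 1 -> K * r ^ M <= b) -> K <= b.
Proof.
intros H.
apply (filterlim_le (F := at_left 1) (fun r => K * r ^ M) (fun _ => b) K b).
- exists (mkposreal 1 Rlt_0_1). intros r Hr Hr1. apply H.
  change (Rabs (r - 1) < 1) in Hr. apply Rabs_def2 in Hr. lra.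
- change (filterlim (fun r : R => K * r ^ M) (at_left 1) (locally K)).
  assert (C : continuous (fun r : R => K * r ^ M) 1).
  { apply (ex_derive_continuous (fun r : R => K * r ^ M)). auto_derive. auto. }
  unfold continuous in C. rewrite pow1, Rmult_1_r in C.
  intros P HP. generalize (C P HP). unfold filtermap, at_left, within.
  apply (filter_imp (F := locally 1)). auto.
- apply filterlim_const.
Qed.

(** For [k >= 1] the weight [(k - b)^2] is at most [k^2] since [b <= 2], so after
    cancellation only [b^2] remains from the term [k = 0]. *)
Lemma coef_bound_of_clunie d b m :
  0 < b <= 2 -> Cmod (d 0%nat) = 1 ->
  (forall r, 0 < r < 1 ->
    sum_n (fun k => Cmod (INR k * d k)%C ^ 2 * r ^ (2 * k)) (S m)
    <= sum_n (fun k => Cmod ((INR k - b)%R * d k)%C ^ 2 * r ^ (2 * k)) m) ->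
  INR (S m) * Cmod (d (S m)) <= b.
Proof.
intros Hb d0 H.
apply (le_of_power_scaled _ _ (S m)). intros r Hr. specialize (H r Hr).
rewrite sum_Sn in H. change plus with Rplus in H.
assert (L : forall m,
   sum_n (fun k => Cmod ((INR k - b)%R * d k)%C ^ 2 * r ^ (2 * k)) m <=
   b ^ 2 + sum_n (fun k => Cmod (INR k * d k)%C ^ 2 * r ^ (2 * k)) m).
{ induction m0.
  - rewrite !sum_O, !Cmod_mult, !Cmod_R, d0. simpl INR.
    replace (0 - b) with (- b) by ring. rewrite Rabs_Ropp, Rabs_R0, Rabs_pos_eq by lra.
    simpl. lra.
  - rewrite !sum_Sn. change plus with Rplus.
    assert (Cmod ((INR (S m0) - b)%R * d (S m0))%C ^ 2 * r ^ (2 * S m0)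
         <= Cmod (INR (S m0) * d (S m0))%C ^ 2 * r ^ (2 * S m0)); [|lra].
    rewrite !Cmod_mult, !Cmod_R, !Rpow_mult_distr, !pow2_abs.
    apply Rmult_le_compat_r; [apply pow_le; lra|].
    apply Rmult_le_compat_r; [apply pow2_ge_0|].
    rewrite S_INR. pose proof (pos_INR m0). nra. }
specialize (L m).
assert (K : (INR (S m) * Cmod (d (S m)) * r ^ S m) ^ 2 <= b ^ 2).
{ rewrite Rpow_mult_distr, <- (pow_mult r), (Nat.mul_comm (S m)).
  rewrite Cmod_mult, Cmod_R, Rabs_pos_eq in H by apply pos_INR. 
  assert (T := Rle_trans _ _ _ H L). rewrite (Rplus_comm (b ^ 2)) in T.
  exact (Rplus_le_reg_l _ _ _ T). }
apply Rsqr_incr_0_var; [|lra]. now rewrite !Rsqr_pow2.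
Qed.

(** The half plane [Re < b / 2] consists of the points closer to [0] than to [b]. *)
Lemma Cmod_lt_of_Re_lt b (w v : C) :
  0 < b -> w <> RtoC 0 -> Re (v / w)%C < b / 2 -> Cmod v < Cmod (v - b * w)%C.
Proof.
intros Hb Hw H.
pose proof (proj1 (Cmod_gt_0 w) Hw) as Pw.
replace v with (v / w * w)%C at 1 by (field; auto).
replace (v - b * w)%C with ((v / w - b) * w)%C by (field; auto).
rewrite !Cmod_mult. apply Rmult_lt_compat_r; auto.
set (p := (v / w)%C) in *.
apply Rsqr_incrst_0; try apply Cmod_ge_0.
unfold Rsqr. pose proof (Cmod2_alt p). pose proof (Cmod2_alt (p - b)%C) as E.
assert (E1 : Re (p - b)%C = Re p - b) by reflexivity.
assert (E2 : Im (p - b)%C = Im p) by (unfold Im, RtoC; simpl; ring).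
rewrite E1, E2 in E. simpl in *. nra.
Qed.

Section Bounds.

Context (alpha : R) (lambda : C) (n : nat) (f h g : C -> C) (a b : nat -> C).
Hypothesis halpha : 1 < alpha <= 3 / 2.
Hypothesis HF : class_F alpha lambda n f h g a b.

Lemma deriv_coefficient_bound m :
  INR (S m) * Cmod (Cps_derive a (S m)) <= 2 * (alpha - 1).
Proof.
destruct HF as [HH nz Hre _].
set (be := 2 * (alpha - 1)).
set (d := Cps_derive a).
assert (Hd : has_expansion (C_derive h) d) by (apply expansion_derive, HH).
assert (HA := expansion_euler _ _ Hd).
assert (HB := expansion_plus _ _ _ _ HA (expansion_scal (- RtoC be) _ _ Hd)).
assert (lt : forall z, unit_disk z ->
  Cmod (z * C_derive (C_derive h) z)%C
  < Cmod (z * C_derive (C_derive h) z + - RtoC be * C_derive h z)%C).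
{ intros z Hz.
  replace (z * C_derive (C_derive h) z + - RtoC be * C_derive h z)%C
    with (z * C_derive (C_derive h) z - be * C_derive h z)%C by ring.
  apply Cmod_lt_of_Re_lt; [unfold be; lra|now apply nz|].
  specialize (Hre z Hz).
  change (1 + Re (z * C_derive (C_derive h) z / C_derive h z)%C < alpha) in Hre.
  unfold be. lra. }
apply coef_bound_of_clunie.
- unfold be. lra.
- unfold d, Cps_derive. rewrite (class_H_a_1 _ _ _ _ _ HH). simpl.
  rewrite Cmult_1_r. apply Cmod_1.
- intros r Hr.
  eapply Rle_trans; [refine (clunie_inequality _ _ _ _ m r HA HB _ _ _ Hr)|].
  + simpl. ring.
  + intros z Hz. apply Rlt_le. now apply lt.
  + intros z Hz E. specialize (lt z Hz). rewrite E, Cmod_0 in lt.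
    pose proof (Cmod_ge_0 (z * C_derive (C_derive h) z)%C). lra.
  + apply Req_le, sum_n_ext. intros k. do 3 f_equal.
    rewrite RtoC_minus. ring.
Qed.

Lemma a_bound k : (2 <= k)%nat ->
  Cmod (a k) <= 2 * (alpha - 1) / (INR (k - 1) * INR k).
Proof.
intros Hk. destruct k as [|[|m]]; try lia.
assert (K := deriv_coefficient_bound m). unfold Cps_derive in K.
rewrite Cmod_mult, Cmod_R, Rabs_pos_eq in K by apply pos_INR.
replace (S (S m) - 1)%nat with (S m) by lia.
pose proof (lt_0_INR (S m) ltac:(lia)). pose proof (lt_0_INR (S (S m)) ltac:(lia)).
apply Rle_div_r; [now apply Rmult_lt_0_compat|]. lra.
Qed.

(** These are the coefficients of [z ^ (j + n)] in [g' = lambda z ^ n h']. *)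
Lemma b_coefficient j : (INR (S (j + n)) * b (S (j + n)) = lambda * Cps_derive a j)%C.
Proof.
destruct HF as [HH _ _ Hdil].
assert (Hd : has_expansion (C_derive h) (Cps_derive a)) by (apply expansion_derive, HH).
assert (Hg : has_expansion (C_derive g) (Cps_derive b)) by (apply expansion_derive, HH).
assert (Hs := expansion_scal lambda _ _ (expansion_mult_pow n _ _ Hd)).
assert (E : has_expansion (C_derive g) (fun k => lambda * shift_coef n (Cps_derive a) k)%C).
{ revert Hs. apply expansion_ext; auto. intros z Hz. rewrite Hdil by auto. ring. }
generalize (expansion_coef_unique _ _ _ Hg E (j + n)).
cbv beta. now rewrite shift_coef_add.
Qed.

Lemma b_modulus j : Cmod (b (S (j + n))) = Cmod lambda * Cmod (Cps_derive a j) / INR (S (j + n)).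
Proof.
assert (K := f_equal Cmod (b_coefficient j)).
rewrite !Cmod_mult, Cmod_R, Rabs_pos_eq in K by apply pos_INR.
pose proof (lt_0_INR (S (j + n)) ltac:(lia)).
rewrite <- K. field. lra.
Qed.

End Bounds.

(** * Principal powers and the binomial series *)

(** The arc cosine that defines the argument hides that it is differentiable on the
    right half plane, also across the positive axis; the arc tangent shows it. *)
Lemma Carg_right w : 0 < Re w -> Carg w = atan (Im w / Re w).
Proof.
destruct w as [x y]. unfold Carg. cbn [Re Im fst snd]. intros Hx.
set (r := Cmod (x, y)).
assert (r2 : r ^ 2 = x ^ 2 + y ^ 2) by apply Cmod2_alt.
assert (Hr : 0 < r).
{ apply Cmod_gt_0. intros E. injection E. intros. lra. }
assert (E : acos (x / r) = atan (Rabs y / x)).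
{ rewrite acos_atan by (apply Rdiv_lt_0_compat; lra). f_equal.
  replace (1 - (x / r)²) with ((Rabs y / r) ^ 2).
  - rewrite sqrt_pow2.
    + field; lra.
    + apply Rdiv_le_0_compat; [apply Rabs_pos|lra].
  - unfold Rsqr, Rdiv. rewrite Rpow_mult_distr, pow2_abs.
    apply Rmult_eq_reg_r with (r ^ 2); [|nra].
    field_simplify; try lra. }
destruct (Rle_dec 0 y) as [Hy|Hy]; rewrite E.
- now rewrite Rabs_pos_eq.
- rewrite Rabs_left by lra. rewrite <- atan_opp. f_equal. field; lra.
Qed.

Lemma curve_Clog c t v :
  curve_deriv c t v -> 0 < Re (c t) -> curve_deriv (fun s => Clog (c s)) t (v / c t)%C.
Proof.
intros [Hx Hy] Hpos.
set (x := fun s => fst (c s)) in *. set (y := fun s => snd (c s)) in *.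
change (0 < x t) in Hpos.
assert (near : locally t (fun s => 0 < x s)).
{ apply (ex_derive_continuous x t (ex_intro _ _ Hx)).
  apply (open_gt 0). exact Hpos. }
assert (Ex : ex_derive x t) by (eexists; eassumption).
assert (Ey : ex_derive y t) by (eexists; eassumption).
assert (D : x t ^ 2 + y t ^ 2 <> 0) by nra.
destruct v as [vx vy]. cbn [fst snd] in Hx, Hy.
split.
- apply is_derive_ext with (fun s => ln (sqrt (x s ^ 2 + y s ^ 2))).
  { reflexivity. }
  auto_derive.
  + repeat split; auto; [|apply sqrt_lt_R0]; nra.
  + rewrite (is_derive_unique (fun s : R => x s) _ _ Hx), (is_derive_unique (fun s : R => y s) _ _ Hy).
    simpl. fold (x t) (y t).
    set (q := x t * (x t * 1) + y t * (y t * 1)).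
    assert (Q0 : 0 < q) by (unfold q; nra).
    assert (sq : sqrt q * sqrt q = q) by (apply sqrt_sqrt; lra).
    assert (0 < sqrt q) by now apply sqrt_lt_R0.
    transitivity ((x t * vx + y t * vy) / (sqrt q * sqrt q)).
    { field. lra. }
    rewrite sq. unfold q in *. field. nra.
- apply is_derive_ext_loc with (fun s => atan (y s / x s)).
  { revert near. apply filter_imp. intros s Hs. symmetry. now apply Carg_right. }
  auto_derive.
  + repeat split; auto. lra.
  + rewrite (is_derive_unique (fun s : R => x s) _ _ Hx), (is_derive_unique (fun s : R => y s) _ _ Hy).
    simpl. fold (x t) (y t). field. repeat split; nra.
Qed.

Lemma curve_Cexp c t v :
  curve_deriv c t v -> curve_deriv (fun s => Cexp (c s)) t (v * Cexp (c t))%C.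
Proof.
intros [Hx Hy].
set (x := fun s => fst (c s)) in *. set (y := fun s => snd (c s)) in *.
assert (Ex : ex_derive x t) by (eexists; eassumption).
assert (Ey : ex_derive y t) by (eexists; eassumption).
split.
- apply is_derive_ext with (fun s => exp (x s) * cos (y s)); [reflexivity|].
  auto_derive; [auto|].
  rewrite (is_derive_unique (fun s : R => x s) _ _ Hx), (is_derive_unique (fun s : R => y s) _ _ Hy).
  simpl. unfold Re, Im. fold (x t) (y t). ring.
- apply is_derive_ext with (fun s => exp (x s) * sin (y s)); [reflexivity|].
  auto_derive; [auto|].
  rewrite (is_derive_unique (fun s : R => x s) _ _ Hx), (is_derive_unique (fun s : R => y s) _ _ Hy).
  simpl. unfold Re, Im. fold (x t) (y t). ring.
Qed.

Lemma Cexp_opp w : (Cexp w * Cexp (- w) = 1)%C.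
Proof.
destruct w as [x y]. unfold Cexp, Copp; simpl. rewrite cos_neg, sin_neg.
assert (E : exp x * exp (- x) = 1) by (rewrite <- exp_plus, Rplus_opp_r; apply exp_0).
pose proof (sin2_cos2 y) as T. unfold Rsqr in T.
unfold Cmult, RtoC; simpl. f_equal.
- transitivity ((exp x * exp (- x)) * (sin y * sin y + cos y * cos y)); [ring|].
  rewrite E, T. ring.
- ring.
Qed.

Lemma Clog_1 : Clog (RtoC 1) = RtoC 0.
Proof.
unfold Clog. rewrite Carg_right by (simpl; lra). rewrite Cmod_1, ln_1.
simpl. unfold RtoC. f_equal. unfold Rdiv. rewrite Rmult_0_l. apply atan_0.
Qed.

Lemma Cexp_0 : Cexp (RtoC 0) = RtoC 1.
Proof. unfold Cexp, RtoC; simpl. rewrite exp_0, cos_0, sin_0. f_equal; ring. Qed.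

(** The generalised binomial coefficients with alternating signs: these are the
    coefficients of [(1 - w) ^ p]. *)
Fixpoint binom_coef (p : R) (i : nat) : R :=
  match i with
  | O => 1
  | S j => (INR j - p) / INR (S j) * binom_coef p j
  end.

(** Each factor satisfies [|j - p| <= j + 1] as long as [0 < p <= 1]. *)
Lemma binom_coef_bound p i : 0 < p <= 1 -> Rabs (binom_coef p i) <= 1.
Proof.
intros Hp. induction i.
- simpl. rewrite Rabs_R1. lra.
- cbn [binom_coef]. rewrite Rabs_mult, <- (Rmult_1_r 1).
  apply Rmult_le_compat; try apply Rabs_pos; auto.
  pose proof (lt_0_INR (S i) ltac:(lia)). pose proof (pos_INR i).
  unfold Rdiv. rewrite Rabs_mult, (Rabs_pos_eq (/ _)) by (left; now apply Rinv_0_lt_compat).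
  apply (Rdiv_le_1 (Rabs (INR i - p))); auto. rewrite S_INR. apply Rabs_le. lra.
Qed.

(** Choice turns the pointwise sums into a function. *)
Lemma bounded_coef_expansion (a : nat -> C) :
  (forall k, Cmod (a k) <= 1) -> exists F, has_expansion F a.
Proof.
intros H.
destruct (functional_choice (fun z l => unit_disk z -> Cpseries a z l)) as [F HF].
2:{ exists F. exact HF. }
intros z. destruct (Rlt_dec (Cmod z) 1) as [Hz|Hz].
2:{ exists (RtoC 0). intros Hz'. now destruct Hz. }
destruct (ex_series_le (K := C_AbsRing) (V := C_CompleteNormedModule)
   (fun k => z ^ k * a k)%C (fun k => Cmod z ^ k)) as [l Hl].
- intros k. change (Cmod (z ^ k * a k)%C <= Cmod z ^ k).
  rewrite Cmod_mult, Cmod_pow. rewrite <- (Rmult_1_r (Cmod z ^ k)) at 2.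
  apply Rmult_le_compat_l; auto. apply pow_le, Cmod_ge_0.
- apply ex_series_geom. rewrite Rabs_pos_eq; auto. apply Cmod_ge_0.
- exists l. intros _. now apply Cpseries_series.
Qed.

Lemma expansion_fun_unique F G a z :
  has_expansion F a -> has_expansion G a -> unit_disk z -> F z = G z.
Proof.
intros HF HG Hz.
refine (Cseries_unique _ _ _ (HF z Hz) (HG z Hz)).
Qed.

Lemma binomial_series_ode p G :
  has_expansion G (fun i => RtoC (binom_coef p i)) ->
  forall w, unit_disk w -> ((1 - w) * C_derive G w = - p * G w)%C.
Proof.
intros H w Hw.
assert (K := expansion_plus _ _ _ _ (expansion_euler _ _ H) (expansion_scal (- RtoC p)%C _ _ H)).
assert (D := expansion_derive _ _ H).
assert (E : C_derive G w = (w * C_derive G w + - p * G w)%C).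
{ refine (expansion_fun_unique _ (fun z => z * C_derive G z + - p * G z)%C _ w D _ Hw). revert K. apply expansion_ext; [reflexivity|].
  intros i. unfold Cps_derive. cbn [binom_coef].
  rewrite <- RtoC_opp, <- !RtoC_mult, <- RtoC_plus. f_equal. field.
  apply not_0_INR. lia. }
transitivity (C_derive G w - w * C_derive G w)%C; [ring|]. rewrite E at 1. ring.
Qed.

Lemma disk_scal (s : R) w : 0 <= s <= 1 -> unit_disk w -> unit_disk (s * w)%C.
Proof.
unfold unit_disk. intros Hs Hw. rewrite Cmod_mult, Cmod_R, Rabs_pos_eq by lra.
pose proof (Cmod_ge_0 w). nra.
Qed.

Lemma disk_Re_1_minus w : unit_disk w -> 0 < Re (1 - w)%C.
Proof.
unfold unit_disk. intros H. pose proof (re_le_Cmod w) as K.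
change (Re (1 - w)%C) with (1 - Re w). pose proof (Rle_abs (Re w)). lra.
Qed.

Lemma curve_segment (z : C) t : curve_deriv (fun s => s * z)%C t z.
Proof.
destruct z as [x y]. split; unfold Cmult, RtoC; simpl; auto_derive; auto; ring.
Qed.

Lemma curve_one_minus (z : C) t : curve_deriv (fun s => 1 - s * z)%C t (- z)%C.
Proof.
destruct z as [x y]. split; unfold Cminus, Cplus, Copp, Cmult, RtoC; simpl; auto_derive; auto; ring.
Qed.

(** By the differential equation, [G (s w) (1 - s w) ^ (- p)] is constant in [s]. *)
Lemma binomial_series_sum p G :
  has_expansion G (fun i => RtoC (binom_coef p i)) ->
  forall w, unit_disk w -> Crpow (1 - w)%C p = G w.
Proof.
intros H w Hw.
set (c := fun s : R => (G (s * w) * Cexp (- p * Clog (1 - s * w)))%C).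
assert (E : c 1 = c 0).
{ apply curve_deriv_0_const. intros t Ht.
  assert (Hd := disk_scal t w Ht Hw).
  assert (P := disk_Re_1_minus _ Hd).
  assert (N : (1 - t * w)%C <> RtoC 0).
  { intros E. rewrite E in P. simpl in P. lra. }
  assert (K1 := curve_deriv_comp G _ t _ _ (expansion_Cderiv _ _ _ H Hd) (curve_segment w t)).
  assert (K2 := curve_Clog _ t _ (curve_one_minus w t) P).
  assert (K3 : curve_deriv (fun _ => - RtoC p)%C t (RtoC 0)).
  { split; apply (is_derive_const (K := R_AbsRing) (V := R_NormedModule)). }
  assert (K4 := curve_Cexp _ t _ (curve_deriv_mult _ _ t _ _ K3 K2)).
  assert (K5 := curve_deriv_mult _ _ t _ _ K1 K4).
  revert K5. apply curve_deriv_eq. cbv beta.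
  set (X := Cexp _).
  assert (O := binomial_series_ode p G H _ Hd).
  transitivity (w * X * ((1 - t * w) * C_derive G (t * w) + p * G (t * w)) / (1 - t * w))%C.
  { field. auto. }
  rewrite O. field. auto. }
unfold c in E. rewrite Cmult_1_l, Cmult_0_l in E.
assert (G0 : G (RtoC 0) = RtoC 1).
{ refine (Cseries_unique _ _ _ (H (RtoC 0) _) _).
  - unfold unit_disk. rewrite Cmod_0. lra.
  - exact (is_pseries_0 (K := C_AbsRing) (V := C_NormedModule) (fun i => RtoC (binom_coef p i))). }
rewrite G0 in E. replace (1 - 0)%C with (RtoC 1) in E by ring.
rewrite Clog_1, Cmult_0_r, Cexp_0, Cmult_1_r in E.
unfold Crpow. set (L := (p * Clog (1 - w))%C) in *.
replace (- p * Clog (1 - w))%C with (- L)%C in E by (unfold L; ring).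
transitivity (Cexp L * (G w * Cexp (- L)))%C.
- rewrite E. ring.
- transitivity (G w * (Cexp L * Cexp (- L)))%C; [ring|]. rewrite Cexp_opp. ring.
Qed.

(** * Lacunary series and integration from the origin *)

(** The coefficients of [z |-> F (z ^ m)] when those of [F] are [a]. *)
Definition lacunary (m : nat) (a : nat -> C) (k : nat) : C :=
  if (k mod m =? 0)%nat then a (k / m)%nat else RtoC 0.

Lemma lacunary_partial_sum m a z N : (1 <= m)%nat ->
  sum_n (G := C_AbelianMonoid) (fun k => z ^ k * lacunary m a k)%C N =
  sum_n (G := C_AbelianMonoid) (fun i => (z ^ m) ^ i * a i)%C (N / m).
Proof.
intros Hm. induction N.
- rewrite Nat.Div0.div_0_l, !sum_O. unfold lacunary.
  now rewrite Nat.Div0.mod_0_l, Nat.Div0.div_0_l.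
(* From [N] to [S N] the quotient by [m] grows exactly at the multiples of [m]. *)
- rewrite sum_Sn, IHN. unfold lacunary.
  pose proof (Nat.div_mod_eq N m) as DN. pose proof (Nat.mod_upper_bound N m ltac:(lia)) as UN.
  destruct (Nat.eq_dec (S (N mod m)) m) as [E|E].
  + assert (Q : S N = (m * S (N / m) + 0)%nat) by lia.
    rewrite <- (Nat.mod_unique (S N) m (S (N / m)) 0 ltac:(lia) Q).
    rewrite <- (Nat.div_unique (S N) m (S (N / m)) 0 ltac:(lia) Q).
    rewrite Nat.eqb_refl, sum_Sn, <- Cpow_mult_r.
    do 3 f_equal. lia.
  + assert (Q : S N = (m * (N / m) + S (N mod m))%nat) by lia.
    rewrite <- (Nat.mod_unique (S N) m (N / m) (S (N mod m)) ltac:(lia) Q).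
    rewrite <- (Nat.div_unique (S N) m (N / m) (S (N mod m)) ltac:(lia) Q).
    cbn [Nat.eqb]. rewrite Cmult_0_r.
    apply (plus_zero_r (G := C_AbelianMonoid)).
Qed.

Lemma disk_pow z m : (1 <= m)%nat -> unit_disk z -> unit_disk (z ^ m)%C.
Proof.
unfold unit_disk. intros Hm Hz. rewrite Cmod_pow.
destruct m as [|m]; [lia|]. pose proof (Cmod_ge_0 z).
assert (0 <= Cmod z ^ m <= 1).
{ split; [now apply pow_le|]. rewrite <- (pow1 m). apply pow_incr. lra. }
simpl. nra.
Qed.

Lemma expansion_lacunary F a m : (1 <= m)%nat ->
  has_expansion F a -> has_expansion (fun z => F (z ^ m)%C) (lacunary m a).
Proof.
intros Hm H z Hz. apply Cpseries_series.
assert (K := proj1 (Cpseries_series _ _ _) (H _ (disk_pow z m Hm Hz))).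
apply (filterlim_ext (fun N => sum_n (G := C_AbelianMonoid) (fun i => (z ^ m) ^ i * a i)%C (N / m))).
{ intros N. symmetry. now apply lacunary_partial_sum. }
apply (filterlim_comp _ _ _ (fun N => (N / m)%nat) _ eventually eventually); [|exact K].
intros Pr [N0 HN0]. exists (m * N0)%nat. intros N HN. apply HN0.
apply Nat.div_le_lower_bound; lia.
Qed.

Definition antideriv_coef (a : nat -> C) (k : nat) : C :=
  match k with O => RtoC 0 | S j => (a j / INR (S j))%C end.

Lemma Cps_derive_antideriv a k : Cps_derive (antideriv_coef a) k = a k.
Proof.
unfold Cps_derive, antideriv_coef. field.
intros E. apply RtoC_inj in E. revert E. apply not_0_INR. lia.
Qed.

Lemma curve_deriv_scal c k t v : curve_deriv c t v -> curve_deriv (fun s => k * c s)%C t (k * v)%C.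
Proof.
intros H.
assert (K : curve_deriv (fun _ => k) t (RtoC 0)).
{ split; apply (is_derive_const (K := R_AbsRing) (V := R_NormedModule)). }
generalize (curve_deriv_mult _ _ t _ _ K H). apply curve_deriv_eq. ring.
Qed.

Lemma curve_FTC (K k : R -> C) :
  (forall t, 0 <= t <= 1 -> curve_deriv K t (k t)) ->
  (forall t, 0 <= t <= 1 -> exists v, curve_deriv k t v) ->
  RInt (V := C_R_CompleteNormedModule) k 0 1 = (K 1 - K 0)%C.
Proof.
intros HK Hk.
apply (is_RInt_unique (V := C_R_CompleteNormedModule)).
apply (is_RInt_fct_extend_pair (U := R_NormedModule) (V := R_NormedModule) k 0 1
  (fst (K 1) - fst (K 0)) (snd (K 1) - snd (K 0))).
- apply (is_RInt_derive (V := R_CompleteNormedModule) (fun t => fst (K t)));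
    rewrite Rmin_left, Rmax_right by lra; intros t Ht.
  + apply HK, Ht.
  + destruct (Hk t Ht) as [v [Hv _]].
    apply (ex_derive_continuous (K := R_AbsRing) (V := R_NormedModule)). eexists. exact Hv.
- apply (is_RInt_derive (V := R_CompleteNormedModule) (fun t => snd (K t)));
    rewrite Rmin_left, Rmax_right by lra; intros t Ht.
  + apply HK, Ht.
  + destruct (Hk t Ht) as [v [_ Hv]].
    apply (ex_derive_continuous (K := R_AbsRing) (V := R_NormedModule)). eexists. exact Hv.
Qed.

(** Let [H] be the sum of the integrated series.  Then [H' = F], and
    [s |-> H (s z) / z] is a primitive of the integrand [s |-> F (s z)]. *)
Lemma Cint0_expansion F a :
  (forall k, Cmod (a k) <= 1) -> has_expansion F a ->
  has_expansion (Cint0 F) (antideriv_coef a).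
Proof.
intros Ha HF.
destruct (bounded_coef_expansion (antideriv_coef a)) as [H HH].
{ intros [|k]; unfold antideriv_coef; [rewrite Cmod_0; lra|].
  assert (1 <= INR (S k)) by (rewrite S_INR; pose proof (pos_INR k); lra).
  rewrite Cmod_div.
  - rewrite Cmod_R, (Rabs_pos_eq (INR _)) by lra. specialize (Ha k).
    apply Rle_div_l; [|rewrite Rmult_1_l; apply Rle_trans with 1; auto]. apply Rlt_le_trans with 1; auto; lra.
  - intros E. apply RtoC_inj in E. lra. }
assert (Hd : forall z, unit_disk z -> C_derive H z = F z).
{ intros z Hz. refine (expansion_fun_unique (C_derive H) F _ z _ HF Hz).
  generalize (expansion_derive _ _ HH). apply expansion_ext; [reflexivity|].
  apply Cps_derive_antideriv. }
assert (H0 : H (RtoC 0) = RtoC 0).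
{ refine (Cseries_unique _ _ _ (HH (RtoC 0) _) _).
  - unfold unit_disk. rewrite Cmod_0. lra.
  - exact (is_pseries_0 (K := C_AbsRing) (V := C_NormedModule) (antideriv_coef a)). }
apply (expansion_ext H _ _ _ ) with (3 := HH); [|reflexivity].
intros z Hz. unfold Cint0.
destruct (Req_EM_T (Cmod z) 0) as [E|E].
{ apply Cmod_eq_0 in E. now rewrite E, Cmult_0_l. }
assert (Nz : z <> RtoC 0) by (intros ->; now rewrite Cmod_0 in E).
rewrite (curve_FTC (fun s => / z * H (s * z))%C).
- rewrite Cmult_1_l, Cmult_0_l, H0. field. auto.
- intros t Ht. assert (Ht' := disk_scal t z Ht Hz).
  generalize (curve_deriv_scal _ (/ z)%C t _
    (curve_deriv_comp H _ t _ _ (expansion_Cderiv _ _ _ HH Ht') (curve_segment z t))).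
  apply curve_deriv_eq. rewrite Hd by auto. field. auto.
- intros t Ht. assert (Ht' := disk_scal t z Ht Hz). eexists.
  exact (curve_deriv_comp F _ t _ _ (expansion_Cderiv _ _ _ HF Ht') (curve_segment z t)).
Qed.

Lemma Cint0_derive F a z :
  (forall k, Cmod (a k) <= 1) -> has_expansion F a -> unit_disk z ->
  C_derive (Cint0 F) z = F z.
Proof.
intros Ha HF Hz. refine (expansion_fun_unique (C_derive (Cint0 F)) F _ z _ HF Hz).
generalize (expansion_derive _ _ (Cint0_expansion F a Ha HF)).
apply expansion_ext; [reflexivity|]. apply Cps_derive_antideriv.
Qed.

Lemma Cderiv_pow m z :
  exists l, Cderiv (fun w => w ^ m)%C z l /\ (z * l = INR m * z ^ m)%C.
Proof.
induction m as [|m [l [D E]]].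
- exists (RtoC 0). split; [exact (Cderiv_const (RtoC 1) z)|]. simpl. ring.
- exists (1 * z ^ m + z * l)%C. split; [exact (Cderiv_mult _ _ z _ _ (Cderiv_id z) D)|].
  rewrite E, S_INR, RtoC_plus. simpl Cpow. ring.
Qed.

(** Equivalently, [(1 + w) / (1 - w)] has positive real part. *)
Lemma Re_half_plane w : unit_disk w -> -1/2 < Re (w / (1 - w))%C.
Proof.
intros Hw. assert (P := disk_Re_1_minus w Hw). unfold unit_disk in Hw.
assert (M : Cmod w ^ 2 < 1) by (pose proof (Cmod_ge_0 w); nra).
rewrite Cmod2_alt in M. destruct w as [x y]. simpl in M, P.
assert (D : 0 < (1 - x) ^ 2 + y ^ 2) by nra.
replace (Re ((x, y) / (1 - (x, y)))%C) with ((x * (1 - x) - y ^ 2) / ((1 - x) ^ 2 + y ^ 2)).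
- apply (Rlt_div_r (-1 / 2) _ _ D). nra.
- simpl. field. repeat split; nra.
Qed.

Lemma Derive_Re_curve (c : R -> C) t v : curve_deriv c t v -> Derive (fun s => Re (c s)) t = Re v.
Proof. intros [H _]. now apply is_derive_unique. Qed.

Lemma Derive_Im_curve (c : R -> C) t v : curve_deriv c t v -> Derive (fun s => Im (c s)) t = Im v.
Proof. intros [_ H]. now apply is_derive_unique. Qed.

Lemma curve_deriv_conj c t v : curve_deriv c t v -> curve_deriv (fun s => Cconj (c s)) t (Cconj v).
Proof.
intros [H1 H2]. split; [exact H1|].
apply (is_derive_opp (K := R_AbsRing) (V := R_NormedModule)). exact H2.
Qed.

Lemma curve_deriv_plus c1 c2 t v1 v2 :
  curve_deriv c1 t v1 -> curve_deriv c2 t v2 -> curve_deriv (fun s => c1 s + c2 s)%C t (v1 + v2)%C.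
Proof.
intros [A1 A2] [B1 B2].
split; now apply (is_derive_plus (K := R_AbsRing) (V := R_NormedModule)).
Qed.

Lemma wirtinger_dz_harmonic h g z lh lg :
  Cderiv h z lh -> Cderiv g z lg ->
  wirtinger_dz (fun w => h w + Cconj (g w))%C z = lh.
Proof.
intros Hh Hg. destruct z as [x y].
assert (Cx : curve_deriv (fun s => (s, y)) x (RtoC 1)).
{ split; simpl; auto_derive; auto. }
assert (Cy : curve_deriv (fun s => (x, s)) y Ci).
{ split; simpl; auto_derive; auto. }
assert (Kx := curve_deriv_plus _ _ x _ _ (curve_deriv_comp h _ x _ _ Hh Cx)
  (curve_deriv_conj _ _ _ (curve_deriv_comp g _ x _ _ Hg Cx))).
assert (Ky := curve_deriv_plus _ _ y _ _ (curve_deriv_comp h _ y _ _ Hh Cy)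
  (curve_deriv_conj _ _ _ (curve_deriv_comp g _ y _ _ Hg Cy))).
unfold wirtinger_dz. cbn [Re Im fst snd].
rewrite (Derive_Re_curve _ _ _ Kx), (Derive_Im_curve _ _ _ Kx),
  (Derive_Re_curve _ _ _ Ky), (Derive_Im_curve _ _ _ Ky).
destruct lh, lg. simpl. f_equal; field.
Qed.

(** * The extremal functions *)

Section Extremal.

Variables (alpha : R) (lambda : C) (n m : nat).
Hypothesis halpha : 1 < alpha <= 3 / 2.
Hypothesis hlambda : Cmod lambda <= 1 / INR (n + 1).
Hypothesis hm : (1 <= m)%nat.

Let p := 2 * (alpha - 1) / INR m.
Let e := lacunary m (fun i => RtoC (binom_coef p i)).
Let F := extremal_deriv alpha (S m).

Lemma extremal_exponent : 0 < p <= 1.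
Proof.
assert (1 <= INR m) by (apply (le_INR 1); auto).
unfold p. split; [apply Rdiv_lt_0_compat; lra|]. apply Rle_div_l; lra.
Qed.

Lemma extremal_coef_bound k : Cmod (e k) <= 1.
Proof.
unfold e, lacunary. destruct (_ =? _)%nat.
- rewrite Cmod_R. apply binom_coef_bound, extremal_exponent.
- rewrite Cmod_0. lra.
Qed.

Lemma extremal_deriv_eq z : F z = Crpow (1 - z ^ m)%C p.
Proof. unfold F, extremal_deriv, p. now rewrite Nat.sub_succ, Nat.sub_0_r. Qed.

Lemma Crpow_neq_0 w q : Crpow w q <> RtoC 0.
Proof.
intros E. unfold Crpow in E. set (u := (q * Clog w)%C) in *.
assert (K := Cexp_opp u). rewrite E, Cmult_0_l in K.
apply (RtoC_inj 0 1) in K. lra.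
Qed.

(** With [w = z ^ m], the equation [(1 - w) G' = - p G] of the binomial series and
    the chain rule give [z F' / F = - m p w / (1 - w)], where [m p] is
    [2 (alpha - 1)]. *)
Lemma extremal_deriv_expansion :
  has_expansion F e /\
  forall z, unit_disk z ->
    (z * C_derive F z / F z = - (2 * (alpha - 1))%R * (z ^ m / (1 - z ^ m)))%C.
Proof.
destruct (bounded_coef_expansion (fun i => RtoC (binom_coef p i))) as [G HG].
{ intros i. rewrite Cmod_R. apply binom_coef_bound, extremal_exponent. }
assert (EG : forall z, unit_disk z -> G (z ^ m)%C = F z).
{ intros z Hz. rewrite extremal_deriv_eq. symmetry. apply binomial_series_sum; auto.
  now apply disk_pow. }
split.
{ generalize (expansion_lacunary G _ m hm HG). now apply expansion_ext. }
intros z Hz.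
destruct (Cderiv_pow m z) as [l [Dl El]].
assert (Hw := disk_pow z m hm Hz).
assert (D := Cderiv_comp G (fun w => w ^ m)%C z _ _ (expansion_Cderiv G _ _ HG Hw) Dl).
assert (D' := Cderiv_ext_disk _ F z _ EG Hz D).
rewrite (is_C_derive_unique _ _ _ D').
assert (O := binomial_series_ode p G HG _ Hw).
assert (N := disk_Re_1_minus _ Hw).
assert (N1 : (1 - z ^ m)%C <> RtoC 0).
{ intros E. rewrite E in N. simpl in N. lra. }
assert (N2 : F z <> RtoC 0) by (rewrite extremal_deriv_eq; apply Crpow_neq_0).
rewrite <- EG in * by auto.
set (w := (z ^ m)%C) in *.
transitivity ((z * l) * ((1 - w) * C_derive G w) / ((1 - w) * G w))%C.
{ field. auto. }
rewrite O, El.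
replace (2 * (alpha - 1))%R with (INR m * p)%R
  by (unfold p; field; apply not_0_INR; lia).
rewrite RtoC_mult. field. auto.
Qed.

Let a := antideriv_coef e.
Let eg := fun k => (lambda * shift_coef n e k)%C.
Let b := antideriv_coef eg.

Lemma extremal_class_F :
  class_F alpha lambda n (extremal_f alpha lambda n (S m)) (extremal_h alpha (S m))
    (extremal_g alpha lambda n (S m)) a b.
Proof.
destruct extremal_deriv_expansion as [HF Hlog].
fold F in HF, Hlog.
set (Fg := fun t => (lambda * t ^ n * F t)%C).
assert (HFg : has_expansion Fg eg).
{ generalize (expansion_scal lambda _ _ (expansion_mult_pow n _ _ HF)).
  apply expansion_ext; [|reflexivity]. intros z _. unfold Fg. ring. }
assert (He := extremal_coef_bound).
(* [|lambda| <= 1 / (n + 1) <= 1], so the bound for [e] carries over. *)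
assert (Heg : forall k, Cmod (eg k) <= 1).
{ intros k. unfold eg. rewrite Cmod_mult.
  assert (1 <= INR (n + 1)) by (apply (le_INR 1); lia).
  assert (Cmod lambda <= 1).
  { eapply Rle_trans; [exact hlambda|]. apply Rle_div_l; lra. }
  assert (Cmod (shift_coef n e k) <= 1).
  { unfold shift_coef. destruct (_ <? _)%nat; [rewrite Cmod_0; lra|apply He]. }
  pose proof (Cmod_ge_0 lambda). pose proof (Cmod_ge_0 (shift_coef n e k)). nra. }
assert (Hh : has_expansion (extremal_h alpha (S m)) a) by exact (Cint0_expansion F e He HF).
assert (Hg : has_expansion (extremal_g alpha lambda n (S m)) b) by exact (Cint0_expansion Fg eg Heg HFg).
assert (Dh : forall z, unit_disk z -> C_derive (extremal_h alpha (S m)) z = F z)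
  by (intros z Hz; exact (Cint0_derive F e z He HF Hz)).
assert (Dg : forall z, unit_disk z -> C_derive (extremal_g alpha lambda n (S m)) z = Fg z)
  by (intros z Hz; exact (Cint0_derive Fg eg z Heg HFg Hz)).
assert (D2h : forall z, unit_disk z -> C_derive (C_derive (extremal_h alpha (S m))) z = C_derive F z).
{ intros z Hz. apply is_C_derive_unique. apply (Cderiv_ext_disk F); auto.
  - intros w Hw. symmetry. now apply Dh.
  - now apply (expansion_Cderiv F e). }
assert (zero_disk : unit_disk (RtoC 0)) by (unfold unit_disk; rewrite Cmod_0; lra).
assert (nzF : forall z, F z <> RtoC 0) by (intros z; rewrite extremal_deriv_eq; apply Crpow_neq_0).
split.
- split; auto.
  + intros z Hz. eexists. now apply (expansion_Cderiv _ a).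
  + intros z Hz. eexists. now apply (expansion_Cderiv _ b).
  + unfold extremal_f, extremal_h, extremal_g, Cint0. rewrite !Cmult_0_l.
    apply injective_projections; simpl; ring.
  + transitivity (C_derive (extremal_h alpha (S m)) (RtoC 0)).
    * apply (wirtinger_dz_harmonic _ _ _ _ (C_derive (extremal_g alpha lambda n (S m)) (RtoC 0))).
      -- now apply (expansion_Cderiv _ a).
      -- now apply (expansion_Cderiv _ b).
    * rewrite Dh by auto. rewrite extremal_deriv_eq.
      destruct m as [|m']; [lia|].
      simpl Cpow. rewrite Cmult_0_l. unfold Crpow.
      replace (1 - 0)%C with (RtoC 1) by ring.
      now rewrite Clog_1, Cmult_0_r, Cexp_0.
  + unfold a, antideriv_coef, e, lacunary.
    rewrite Nat.Div0.mod_0_l, Nat.Div0.div_0_l. simpl. field.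
- intros z Hz. rewrite Dh by auto. apply nzF.
- intros z Hz. rewrite D2h, Dh, Hlog by auto.
  assert (K := Re_half_plane _ (disk_pow z m hm Hz)).
  set (w := (z ^ m / (1 - z ^ m))%C) in *.
  replace (Re (1 + - (2 * (alpha - 1))%R * w)%C) with (1 - 2 * (alpha - 1) * Re w).
  + nra.
  + unfold Re. simpl. ring.
- intros z Hz. rewrite Dg, Dh by auto. reflexivity.
Qed.

Lemma extremal_coef_modulus : Cmod (e m) = p.
Proof.
unfold e, lacunary. rewrite Nat.Div0.mod_same, Nat.div_same by lia.
simpl Nat.eqb. cbv iota. cbn [binom_coef]. simpl INR.
rewrite Cmod_R. replace ((0 - p) / 1 * 1) with (- p) by field.
rewrite Rabs_Ropp, Rabs_pos_eq; auto. pose proof extremal_exponent. lra.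
Qed.

Lemma extremal_sharp :
  Cmod (a (S m)) = 2 * (alpha - 1) / (INR m * INR (S m)) /\
  Cmod (b (n + 1)) = Cmod lambda / INR (n + 1) /\
  Cmod (b (S m + n)) = 2 * Cmod lambda * (alpha - 1) / (INR m * INR (S m + n)).
Proof.
assert (Hc := extremal_class_F).
assert (Nm : INR m <> 0) by (apply not_0_INR; lia).
assert (Da : Cps_derive a m = e m) by apply Cps_derive_antideriv.
split; [|split].
- assert (K := f_equal Cmod Da). unfold Cps_derive in K.
  rewrite Cmod_mult, Cmod_R, Rabs_pos_eq, extremal_coef_modulus in K by apply pos_INR.
  assert (NS : INR (S m) <> 0) by (apply not_0_INR; lia).
  apply Rmult_eq_reg_l with (INR (S m)); auto. rewrite K. unfold p. field. auto.
- replace (n + 1)%nat with (S (0 + n)) by lia.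
  rewrite (b_modulus _ _ _ _ _ _ _ _ Hc 0).
  unfold Cps_derive. rewrite (class_H_a_1 _ _ _ _ _ (class_F_H _ _ _ _ _ _ _ _ Hc)).
  simpl INR at 1. rewrite Cmult_1_r, Cmod_1. rewrite Rmult_1_r. reflexivity.
- change (S m + n)%nat with (S (m + n)).
  rewrite (b_modulus _ _ _ _ _ _ _ _ Hc m), Da, extremal_coef_modulus.
  unfold p. field. split; auto. apply not_0_INR; lia.
Qed.

End Extremal.

Theorem theorem2 (n : nat) (alpha : R) (lambda : C)
    (hn : (1 <= n)%nat)
    (halpha : 1 < alpha <= 3 / 2)
    (hlambda : Cmod lambda <= 1 / INR (n + 1)) :
  (forall (f h g : C -> C) (a b : nat -> C),
     class_F alpha lambda n f h g a b ->
     (forall k : nat, (2 <= k)%nat ->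
        Cmod (a k) <= 2 * (alpha - 1) / (INR (k - 1) * INR k)) /\
     Cmod (b (n + 1)%nat) <= Cmod lambda / INR (n + 1) /\
     (forall k : nat, (2 <= k)%nat ->
        Cmod (b (k + n)%nat)
        <= 2 * Cmod lambda * (alpha - 1) / (INR (k - 1) * INR (k + n)))) /\
  (forall k : nat, (2 <= k)%nat ->
     exists a b : nat -> C,
       class_F alpha lambda n
         (extremal_f alpha lambda n k) (extremal_h alpha k)
         (extremal_g alpha lambda n k) a b /\
       Cmod (a k) = 2 * (alpha - 1) / (INR (k - 1) * INR k) /\
       Cmod (b (n + 1)%nat) = Cmod lambda / INR (n + 1) /\
       Cmod (b (k + n)%nat)
       = 2 * Cmod lambda * (alpha - 1) / (INR (k - 1) * INR (k + n))).
Proof.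
split.
- intros f h g a b HF. split; [|split].
  + exact (a_bound _ _ _ _ _ _ _ _ halpha HF).
  + apply Req_le. replace (n + 1)%nat with (S (0 + n)) by lia.
    rewrite (b_modulus _ _ _ _ _ _ _ _ HF 0).
    unfold Cps_derive. rewrite (class_H_a_1 _ _ _ _ _ (class_F_H _ _ _ _ _ _ _ _ HF)).
    simpl INR at 1. rewrite Cmult_1_r, Cmod_1, Rmult_1_r. reflexivity.
  + intros [|[|m]] Hk; [lia|lia|].
    change (S (S m) + n)%nat with (S (S m + n)).
    rewrite (b_modulus _ _ _ _ _ _ _ _ HF (S m)).
    replace (S (S m) - 1)%nat with (S m) by lia.
    assert (K := deriv_coefficient_bound _ _ _ _ _ _ _ _ halpha HF m).
    pose proof (lt_0_INR (S m) ltac:(lia)). pose proof (lt_0_INR (S (S m + n)) ltac:(lia)).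
    replace (2 * Cmod lambda * (alpha - 1) / (INR (S m) * INR (S (S m + n))))
      with (Cmod lambda * (2 * (alpha - 1) / INR (S m)) / INR (S (S m + n))) by (field; lra).
    apply Rmult_le_compat_r; [left; now apply Rinv_0_lt_compat|].
    apply Rmult_le_compat_l; [apply Cmod_ge_0|].
    apply Rle_div_r; auto. lra.
- intros [|[|m]] Hk; [lia|lia|].
  eexists. eexists. split.
  + apply (extremal_class_F alpha lambda n (S m)); auto; lia.
  + replace (S (S m) - 1)%nat with (S m) by lia.
    apply extremal_sharp; auto; lia.
Qed.
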